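(* Let $\delta\in(0,1/2]$, $K\in\mathbb N$, $C_{R,0}>C_y$, and $\alpha\in\bigl(0,2/(\lambda_{\max}(\mathcal B^*_0)+\lambda_{\min}(\mathcal B^*_0))\bigr)$. There exist constants $C_1>0$ depending only on $\sigma,\mu_0$, and $C_\gamma,C>0$ depending only on $(\alpha,\gamma,\sigma,M,\mathcal D,\mu_0,C_{R,0},K)$, such that whenever $N^{2\beta-1}\ge\frac{C_1}{(C_{R,0}-C_y)^2}\frac1\delta$ and $\gamma\ge C_\gamma N^{-(1-\beta)}$, $$\mathbb P\Bigl(\|f^N_{\theta_K}(\mathbf x)-\mathbf y\|_2\le\frac{C\sqrt M}{\delta}\Bigl(\frac1{N^{\beta-1/2}}+\frac1{N^{1-\beta}}+\frac{\log M}{N^{1/2}}\Bigr)+\bigl(1-\alpha\lambda_{\min}(\mathcal B^*_0)\bigr)^K\|\mathbf y\|_2\Bigr)\ge1-2\delta.$$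
   Context: Fix integers $d,M,N\ge1$, $\beta\in(1/2,1)$. The activation $\sigma:\mathbb R\to\mathbb R$ is twice differentiable, non-polynomial, with $|\sigma|\le C_\sigma$, $|\sigma'|\le C_{\sigma'}$, $|\sigma''|\le C_{\sigma''}$, and $\sigma,\sigma'$ Lipschitz with constants $L_\sigma,L_{\sigma'}$. The data $\mathcal D=(x^m,y^m)_{m=1}^M$ satisfy $\|x^m\|_2\le C_x$, $|y^m|\le C_y$, $x^m\ne0$, and the lines $\{\xi x^m\}$ pairwise meet only at the origin; $\mathbf x=(x^1,\dots,x^M)$, $\mathbf y=(y^m)_m$. For $\theta=(\theta^i)_{i=1}^N$, $\theta^i=(c^i,w^i,\eta^i)\in\mathbb R\times\mathbb R^d\times\mathbb R$: $f^N_\theta(x)=N^{-\beta}\sum_ic^i\sigma(w^i\cdot x+\eta^i)$, $f^N_\theta(\mathbf x)=(f^N_\theta(x^m))_m$, $L^N(\theta)=\frac1{2M}\|\mathbf y-f^N_\theta(\mathbf x)\|_2^2$. Initialization $\theta_0^i$ i.i.d. $\sim\mu_0$, where under $\mu_0$ $c$ is independent of $(w,\eta)$, $c$ is mean zero with compact support, and the law of $(w,\eta)$ charges every set of positive Lebesgue measure. Training: $\gamma>0$, $\gamma^N=\gamma/N^{2\beta-1}$, $\theta_{k+1}=\theta_k+\alpha z^N_k$, $(\gamma^NI+\nabla^2_\theta L^N(\theta_k))z^N_k=-\nabla_\theta L^N(\theta_k)$ (the event includes unique solvability up to step $K$). $(B^*_0)_{mn}=\frac1M\int[\sigma(w\cdot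 x^m+\eta)\sigma(w\cdot x^n+\eta)+c^2\sigma'(w\cdot x^m+\eta)\sigma'(w\cdot x^n+\eta)(x^m\cdot x^n+1)]d\mu_0(c,w,\eta)$, $\mathcal B^*_0=B^*_0(\gamma I_M+B^*_0)^{-1}$ (symmetric) with extreme eigenvalues $\lambda_{\min},\lambda_{\max}$. Dependence on $\sigma$ means on its bound/Lipschitz constants; on $\mathcal D$ means on $d,C_x,C_y$. *)

(* Defs.v *)
From HB Require Import structures.
From mathcomp Require Import all_boot all_order all_algebra.
From mathcomp Require Import all_classical all_reals all_analysis.
Set Implicit Arguments. Unset Strict Implicit. Unset Printing Implicit Defensive.
Import Order.TTheory GRing.Theory Num.Theory.
Import numFieldNormedType.Exports.
Local Open Scope classical_set_scope.
Local Open Scope ring_scope.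

Section Defs.
Variable R : realType.

Definition dotv n (u v : 'rV[R]_n) : R := \sum_(j < n) u 0 j * v 0 j.
Definition norm2 n (u : 'rV[R]_n) : R := Num.sqrt (\sum_(j < n) u 0 j ^+ 2).
Definition norm2f n (u : 'I_n -> R) : R := Num.sqrt (\sum_(j < n) u j ^+ 2).

Definition box n (a b : n.-tuple R) : set (n.-tuple R) :=
  [set t | forall j, tnth a j <= tnth t j <= tnth b j].
Definition boxvol n (a b : n.-tuple R) : R := \prod_(j < n) (tnth b j - tnth a j).
Definition lebesgue_null n (A : set (n.-tuple R)) : Prop :=
  forall e : R, 0 < e -> exists a b : nat -> n.-tuple R,
    (forall k j, tnth (a k) j <= tnth (b k) j) /\
    A `<=` \bigcup_k box (a k) (b k) /\
    (forall K : nat, \sum_(k < K) boxvol (a k) (b k) <= e).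

(* ---------- parameter space of one neuron: theta = (c, (w, eta)) ---------- *)
(* (w, eta) is a (d+1)-tuple: coordinates 0..d-1 are w, coordinate d is eta. *)
Definition param (d : nat) := (R * (d.+1).-tuple R)%type.

Definition wof d (p : param d) (j : 'I_d) : R := tnth p.2 (widen_ord (leqnSn d) j).
Definition etaof d (p : param d) : R := tnth p.2 ord_max.

Definition good_init d (mu0 : probability (param d) R) : Prop :=
  (forall (A : set R) (B : set ((d.+1).-tuple R)), measurable A -> measurable B ->
     mu0 (A `*` B) = (mu0 (A `*` setT) * mu0 (setT `*` B))%E) /\
  (exists Cc : R, mu0 [set p : param d | Cc < `|p.1|] = 0%E) /\
  (\int[mu0]_p (p.1)%:E = 0)%E /\
  (forall B : set ((d.+1).-tuple R), measurable B -> ~ lebesgue_null B ->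
     (0 < mu0 (setT `*` B))%E).

Definition lipschitz (f : R -> R) (L : R) := forall x y, `|f x - f y| <= L * `|x - y|.

Definition good_activation (sigma : R -> R) (Cs Cs' Cs'' Ls Ls' : R) : Prop :=
  (forall x, derivable sigma x 1) /\
  (forall x, derivable (derive1 sigma) x 1) /\
  ~ (exists p : {poly R}, forall x, sigma x = p.[x]) /\
  (forall x, `|sigma x| <= Cs) /\
  (forall x, `|(derive1 sigma) x| <= Cs') /\
  (forall x, `|(derive1n 2 sigma) x| <= Cs'') /\
  lipschitz sigma Ls /\ lipschitz (derive1 sigma) Ls'.

Definition good_data d M (x : 'I_M -> 'rV[R]_d) (y : 'I_M -> R) (Cx Cy : R) : Prop :=
  (forall m, norm2 (x m) <= Cx) /\ (forall m, `|y m| <= Cy) /\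
  (forall m, x m != 0) /\
  (forall m n, m != n -> forall xi xi' : R, xi *: x m = xi' *: x n -> xi *: x m = 0).

Definition Bstar0 d M (mu0 : probability (param d) R) (sigma : R -> R)
    (x : 'I_M -> 'rV[R]_d) : 'M[R]_M :=
  \matrix_(m < M, n < M)
    ((M%:R)^-1 * fine (\int[mu0]_p
      (sigma (dotv (\row_j wof p j) (x m) + etaof p) *
       sigma (dotv (\row_j wof p j) (x n) + etaof p) +
       p.1 ^+ 2 * (derive1 sigma) (dotv (\row_j wof p j) (x m) + etaof p) *
       (derive1 sigma) (dotv (\row_j wof p j) (x n) + etaof p) *
       (dotv (x m) (x n) + 1))%:E)).

Definition calBstar0 M (gamma : R) (B : 'M[R]_M) : 'M[R]_M :=
  B *m invmx (gamma%:M + B).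

Definition is_min_eig n (A : 'M[R]_n) (l : R) : Prop :=
  eigenvalue A l /\ forall a, eigenvalue A a -> l <= a.
Definition is_max_eig n (A : 'M[R]_n) (l : R) : Prop :=
  eigenvalue A l /\ forall a, eigenvalue A a -> a <= l.

(* The full parameter theta = (theta^i)_{i<N} is a flat vector in R^{N(d+2)};
   vec_mx theta is the N x (d+2) matrix whose row i is (c^i, w^i, eta^i):
   column 0 = c^i, columns 1..d = w^i, column d+1 = eta^i. *)
Definition cof N d (th : 'rV[R]_(N * d.+2)) (i : 'I_N) : R := vec_mx th i ord0.
Definition wofth N d (th : 'rV[R]_(N * d.+2)) (i : 'I_N) (j : 'I_d) : R :=
  vec_mx th i (lift ord0 (widen_ord (leqnSn d) j)).
Definition etaofth N d (th : 'rV[R]_(N * d.+2)) (i : 'I_N) : R := vec_mx th i ord_max.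

Definition fnet (beta : R) N d (sigma : R -> R) (th : 'rV[R]_(N * d.+2))
    (xx : 'rV[R]_d) : R :=
  (N%:R) `^ (- beta) *
  \sum_(i < N) cof th i * sigma (\sum_(j < d) wofth th i j * xx 0 j + etaofth th i).

Definition loss (beta : R) N d M (sigma : R -> R) (x : 'I_M -> 'rV[R]_d)
    (y : 'I_M -> R) (th : 'rV[R]_(N * d.+2)) : R :=
  (2 * M%:R)^-1 * \sum_(m < M) (y m - fnet beta sigma th (x m)) ^+ 2.

Definition gradv P (F : 'rV[R]_P -> R) (th : 'rV[R]_P) : 'rV[R]_P :=
  \row_a ('D_(delta_mx 0 a) F th).
Definition hessm P (F : 'rV[R]_P -> R) (th : 'rV[R]_P) : 'M[R]_P :=
  \matrix_(a, b) ('D_(delta_mx 0 a) (fun th' => 'D_(delta_mx 0 b) F th') th).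

Definition sysmat P (gN : R) (F : 'rV[R]_P -> R) (th : 'rV[R]_P) : 'M[R]_P :=
  gN%:M + hessm F th.

Definition lmstep P (alpha gN : R) (F : 'rV[R]_P -> R) (th : 'rV[R]_P) : 'rV[R]_P :=
  th + alpha *: (- (invmx (sysmat gN F th) *m (gradv F th)^T))^T.

Definition init_param N d (th0 : 'I_N -> param d) : 'rV[R]_(N * d.+2) :=
  mxvec (\matrix_(i < N, j < d.+2)
           (if j == ord0 then (th0 i).1 else tnth (th0 i).2 (inord j.-1))).

Definition iid_law dO (Omega : measurableType dO) (P : probability Omega R) N d
    (mu0 : probability (param d) R) (th0 : 'I_N -> Omega -> param d) : Prop :=
  (forall i, measurable_fun setT (th0 i)) /\
  (forall i (A : set (param d)), measurable A -> P (th0 i @^-1` A) = mu0 A) /\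
  (forall A : 'I_N -> set (param d), (forall i, measurable (A i)) ->
     fine (P [set w | forall i, A i (th0 i w)]) = \prod_(i < N) fine (P (th0 i @^-1` A i))).

End Defs.

(* Main.v *)
(** With [s = N ^ (- beta)] and [h = N ^ (beta - 1)] one has [N s h = 1] and [gamma^N = gamma s / h].
    Testing the linear system of one Levenberg-Marquardt step against the step [z] itself, against
    the block of [z] belonging to one neuron, and against the gradient of the n-th network output
    shows successively that the linearly predicted residual [P = D f(z) + r] is bounded, that every
    neuron moves by [O(h)], and that [gamma (P - r) + B P = O(h)], where [B] is the empirical kernel.
    The Taylor remainder of the network and the drift of [B] in one step are [O(h)] as well, so
    that the residual evolves by [r' = (1 - alpha b (gamma + b)^-1) r] up to [O(h + |B_0 - b|)],
    where [b] is the limit kernel [Bstar0]. Only the positivity of [b] is needed to propagate this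
    over [K] steps; the contraction factor of the unperturbed recursion applied to [y] comes from
    the spectral theorem. The network at initialization and [B_0 - b] are averages of independent
    centered bounded variables, and are controlled through their second moments. *)
Require Import Defs.
From HB Require Import structures.
From mathcomp Require Import all_boot all_order all_algebra.
From mathcomp Require Import all_classical all_reals all_analysis.
From mathcomp Require Import measurable_realfun complex.
From mathcomp Require Import ring lra.
Set Implicit Arguments. Unset Strict Implicit. Unset Printing Implicit Defensive.
Import Order.TTheory GRing.Theory Num.Theory.
Import numFieldNormedType.Exports.
Local Open Scope classical_set_scope.
Local Open Scope ring_scope.

(** [C] and [Cgamma] are fixed before [N], [beta], [delta], the activation and the data points, so
    no constant may involve the smallest eigenvalue of the limit kernel, which may degenerate as
    data points approach each other. This is why the propagation rests on energy estimates: for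
    positive [b] the operator [gamma (gamma + b)^-1] has norm at most 1 whatever the spectrum. [M]
    and [K] are fixed earlier than the constants, which permits entrywise bounds losing powers of
    [M] and constants that grow with every step. The loss is not convex. The indefinite part of its
    Hessian, residual times second differential of the network, is [O(s)] on the block of each
    neuron, whereas the damping is [gamma s / h]; the condition [gamma >= Cgamma h] keeps the former
    below half of the latter. Hence every linear system is coercive, which yields both its unique
    solvability and the bounds on its solution. *)

(** * Calculus of directional derivatives *)

Section DirectionalDerivatives.
Variable R : realType.

(** The two difference quotients are the same function of the increment. Restricting to a line
    reduces the chain rule with [sigma] to one real variable, so that only directional derivatives
    are ever handled. *)
Lemma is_derive_line (V : normedModType R) (F : V -> R) (a v : V) (l : R) :
  is_derive (0 : R) 1 (fun t : R => F (t *: v + a)) l <-> is_derive a v F l.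
Proof.
have E : (fun h : R => h^-1 *: (((fun t : R => F (t *: v + a)) \o shift 0)
      (h *: (1 : R)) - F (0 *: v + a))) =
    (fun h : R => h^-1 *: ((F \o shift a) (h *: v) - F a)).
  by apply/funext => h /=; rewrite scale0r add0r addr0 [h *: 1]mulr1.
by split=> -[ed dv]; split; move: ed dv; rewrite /derivable /derive /= E.
Qed.

Lemma is_derive_compr (V : normedModType R) (g : R -> R) (F : V -> R) (a v : V)
    (l : R) : derivable g (F a) 1 -> is_derive a v F l ->
  is_derive a v (fun y => g (F y)) (derive1 g (F a) * l).
Proof.
move=> dg /is_derive_line dF; apply/is_derive_line.
apply: is_derive1_comp => /=.
by rewrite scale0r add0r derive1E; apply/derivableP.
Qed.

Lemma is_derive_lin (V : normedModType R) (F : V -> R) (a v : V) :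
  (forall t, F (t *: v + a) = t * F v + F a) -> is_derive a v F (F v).
Proof.
move=> linF; apply/is_derive_line.
rewrite (_ : (fun _ => _) = (F v \*: id) + cst (F a)).
  apply: is_derive_eq; first by rewrite addr0; exact: mulr1.
by apply/funext => t; rewrite linF fctE /= mulrC.
Qed.

Lemma is_derive_sumf (V : normedModType R) n (F : 'I_n -> V -> R) (a v : V)
    (l : 'I_n -> R) : (forall i, is_derive a v (F i) (l i)) ->
  is_derive a v (fun y => \sum_(i < n) F i y) (\sum_(i < n) l i).
Proof. by move=> dF; rewrite -fct_sumE; exact: is_derive_sum. Qed.

Lemma is_derive_mulf (V : normedModType R) (F G : V -> R) (a v : V) (l k : R) :
  is_derive a v F l -> is_derive a v G k ->
  is_derive a v (fun y => F y * G y) (F a * k + G a * l).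
Proof. exact: is_deriveM. Qed.

Lemma is_derive_scalef (V : normedModType R) (F : V -> R) (a v : V) (c l : R) :
  is_derive a v F l -> is_derive a v (fun y => c * F y) (c * l).
Proof. exact: is_deriveZ. Qed.

Lemma is_derive_addf (V : normedModType R) (F G : V -> R) (a v : V) (l k : R) :
  is_derive a v F l -> is_derive a v G k ->
  is_derive a v (fun y => F y + G y) (l + k).
Proof. exact: is_deriveD. Qed.

End DirectionalDerivatives.

(** * First and second differentials of the network and of the loss *)

Section Network.
Variables (R : realType) (N d : nat).
Notation V := 'rV[R]_(N * d.+2).

Definition preact (xx : 'rV[R]_d) (v : V) (i : 'I_N) : R :=
  \sum_(j < d) wofth v i j * xx 0 j + etaofth v i.

Lemma cof_lin i t (v w : V) : cof (t *: v + w) i = t * cof v i + cof w i.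
Proof. by rewrite /cof linearP !mxE. Qed.

Lemma wofth_lin i j t (v w : V) :
  wofth (t *: v + w) i j = t * wofth v i j + wofth w i j.
Proof. by rewrite /wofth linearP !mxE. Qed.

Lemma etaofth_lin i t (v w : V) :
  etaofth (t *: v + w) i = t * etaofth v i + etaofth w i.
Proof. by rewrite /etaofth linearP !mxE. Qed.

Lemma preact_lin xx i t (v w : V) :
  preact xx (t *: v + w) i = t * preact xx v i + preact xx w i.
Proof.
rewrite /preact etaofth_lin mulrDr mulr_sumr [RHS]addrACA -big_split /=.
by congr (_ + _); apply: eq_bigr => j _; rewrite wofth_lin mulrDl mulrA.
Qed.

Variables (sigma : R -> R) (beta : R).
Let s := N%:R `^ (- beta).
Hypothesis dsigma : forall x, derivable sigma x 1.
Hypothesis ddsigma : forall x, derivable (derive1 sigma) x 1.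

Definition dnet (xx : 'rV[R]_d) (th v : V) : R :=
  s * \sum_(i < N) (cof v i * sigma (preact xx th i) +
                    cof th i * derive1 sigma (preact xx th i) * preact xx v i).

(** The second differential of the network is block diagonal over the neurons. The contribution of
    one neuron is kept apart because it is later bounded by the squared norm of that block alone and
    isolated by a test vector supported there. *)
Definition ddnet_at (xx : 'rV[R]_d) (th v w : V) (i : 'I_N) : R :=
  cof v i * derive1 sigma (preact xx th i) * preact xx w i +
  cof w i * derive1 sigma (preact xx th i) * preact xx v i +
  cof th i * derive1n 2 sigma (preact xx th i) * preact xx v i * preact xx w i.

Definition ddnet xx th v w := s * \sum_(i < N) ddnet_at xx th v w i.

Lemma dnet_lin xx th t v w :
  dnet xx th (t *: v + w) = t * dnet xx th v + dnet xx th w.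
Proof.
rewrite /dnet mulrCA -mulrDr; congr (_ * _); rewrite mulr_sumr -big_split /=.
by apply: eq_bigr => i _; rewrite cof_lin preact_lin; ring.
Qed.

Lemma ddnet_linl xx th t v v' w :
  ddnet xx th (t *: v + v') w = t * ddnet xx th v w + ddnet xx th v' w.
Proof.
rewrite /ddnet mulrCA -mulrDr; congr (_ * _); rewrite mulr_sumr -big_split /=.
by apply: eq_bigr => i _; rewrite /ddnet_at cof_lin preact_lin; ring.
Qed.

Lemma ddnetC xx th v w : ddnet xx th v w = ddnet xx th w v.
Proof.
by congr (_ * _); apply: eq_bigr => i _; rewrite /ddnet_at; ring.
Qed.

Lemma is_derive_fnet xx th v :
  is_derive th v (fun y => fnet beta sigma y xx) (dnet xx th v).
Proof.
apply: is_derive_scalef; apply: is_derive_sumf => i.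
apply: is_derive_eq.
  apply: is_derive_mulf.
    by apply: (@is_derive_lin _ _ (fun y => cof y i)) => t; exact: cof_lin.
  apply: (@is_derive_compr _ _ sigma (fun y => preact xx y i)) => //.
  by apply: (@is_derive_lin _ _ (fun y => preact xx y i)) => t; exact: preact_lin.
by rewrite /preact; ring.
Qed.

Lemma is_derive_dnet xx th v w :
  is_derive th w (fun y => dnet xx y v) (ddnet xx th v w).
Proof.
apply: is_derive_scalef; apply: is_derive_sumf => i.
have dp : is_derive th w (fun y => preact xx y i) (preact xx w i).
  by apply: (@is_derive_lin _ _ (fun y => preact xx y i)) => t; exact: preact_lin.
have dc : is_derive th w (fun y => cof y i) (cof w i).
  by apply: (@is_derive_lin _ _ (fun y => cof y i)) => t; exact: cof_lin.
apply: is_derive_eq.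
  apply: is_derive_addf.
    apply: is_derive_scalef.
    by apply: (@is_derive_compr _ _ sigma (fun y => preact xx y i)).
  apply: is_derive_mulf.
  apply: is_derive_mulf.
  by apply: (@is_derive_compr _ _ (derive1 sigma) (fun y => preact xx y i)).
by rewrite /ddnet_at /=; ring.
Qed.

Variables (M : nat) (x : 'I_M -> 'rV[R]_d) (y : 'I_M -> R).
Hypothesis M0 : (0 < M)%N.
Let resid (th : V) (m : 'I_M) : R := fnet beta sigma th (x m) - y m.

Lemma derive_loss th v : 'D_v (loss beta sigma x y) th =
  M%:R^-1 * \sum_(m < M) resid th m * dnet (x m) th v.
Proof.
have M0' : M%:R != 0 :> R by rewrite pnatr_eq0 -lt0n.
suff : is_derive th v (loss beta sigma x y)
  (M%:R^-1 * \sum_(m < M) resid th m * dnet (x m) th v) by case.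
apply: is_derive_eq.
  apply: is_derive_scalef; apply: is_derive_sumf => m.
  apply: (@is_derive_mulf _ _ (fun z => y m - fnet beta sigma z (x m))
           (fun z => y m - fnet beta sigma z (x m))); apply: is_derive_addf;
  by [exact: is_derive_cst|apply: is_deriveN; exact: is_derive_fnet].
rewrite !mulr_sumr; apply: eq_bigr => m _; rewrite /resid; field.
by rewrite M0'.
Qed.

Lemma derive2_loss th v w :
  'D_w (fun th' => 'D_v (loss beta sigma x y) th') th =
  M%:R^-1 * \sum_(m < M) (dnet (x m) th v * dnet (x m) th w +
                          resid th m * ddnet (x m) th v w).
Proof.
rewrite (_ : (fun _ => _) = fun th' =>
  M%:R^-1 * \sum_(m < M) resid th' m * dnet (x m) th' v); last first.
  by apply/funext => th'; rewrite derive_loss.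
suff : is_derive th w (fun th' =>
  M%:R^-1 * \sum_(m < M) resid th' m * dnet (x m) th' v)
  (M%:R^-1 * \sum_(m < M) (dnet (x m) th v * dnet (x m) th w +
                          resid th m * ddnet (x m) th v w)) by case.
apply: is_derive_eq.
  apply: is_derive_scalef; apply: is_derive_sumf => m.
  apply: is_derive_mulf; last exact: is_derive_dnet.
  by apply: is_derive_addf; exact: is_derive_fnet.
by congr (_ * _); apply: eq_bigr => m _; rewrite /resid; ring.
Qed.

Lemma row_deltaE n (v : 'rV[R]_n) : v = \sum_(a < n) v 0 a *: delta_mx 0 a.
Proof. by rewrite {1}(matrix_sum_delta v) big_ord1. Qed.

(** Passes from the coordinatewise [gradv] and [hessm] to linear and bilinear forms in arbitrary
    directions. *)
Lemma linear_row_sum n (F : 'rV[R]_n -> R) (v : 'rV[R]_n) :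
  (forall t u w, F (t *: u + w) = t * F u + F w) ->
  F v = \sum_(a < n) v 0 a * F (delta_mx 0 a).
Proof.
move=> linF; have F0 : F 0 = 0.
  by have := linF (-1) 0 0; rewrite scaler0 addr0; lra.
rewrite {1}(row_deltaE v); elim/big_rec2: _ => // a r u _ <-.
by rewrite linF.
Qed.

Lemma grad_form th v : (v *m (gradv (loss beta sigma x y) th)^T) 0 0 =
  M%:R^-1 * \sum_(m < M) resid th m * dnet (x m) th v.
Proof.
rewrite [RHS](@linear_row_sum _
  (fun v => M%:R^-1 * \sum_(m < M) resid th m * dnet (x m) th v)); last first.
  move=> t u w; rewrite mulrCA -mulrDr; congr (_ * _).
  by rewrite mulr_sumr -big_split /=; apply: eq_bigr => m _; rewrite dnet_lin; ring.
by rewrite !mxE; apply: eq_bigr => a _; rewrite !mxE derive_loss.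
Qed.

Lemma hess_form th v w : (v *m hessm (loss beta sigma x y) th *m w^T) 0 0 =
  M%:R^-1 * \sum_(m < M) (dnet (x m) th v * dnet (x m) th w +
                          resid th m * ddnet (x m) th v w).
Proof.
pose B v w := M%:R^-1 * \sum_(m < M) (dnet (x m) th v * dnet (x m) th w +
                          resid th m * ddnet (x m) th v w).
have BC u1 u2 : B u1 u2 = B u2 u1.
  by congr (_ * _); apply: eq_bigr => m _; rewrite ddnetC; ring.
have linB u t u1 u2 : B (t *: u1 + u2) u = t * B u1 u + B u2 u.
  rewrite /B mulrCA -mulrDr; congr (_ * _).
  by rewrite mulr_sumr -big_split /=; apply: eq_bigr => m _; rewrite dnet_lin ddnet_linl; ring.
rewrite -/(B v w) (@linear_row_sum _ (fun v => B v w)) //.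
rewrite -mulmxA !mxE; apply: eq_bigr => a _; congr (_ * _).
rewrite BC (@linear_row_sum _ (fun w => B w (delta_mx 0 a))) //.
rewrite !mxE; apply: eq_bigr => b _; rewrite !mxE derive2_loss mulrC.
by [].
Qed.

Lemma dotvE n (u v : 'rV[R]_n) : (u *m v^T) 0 0 = dotv u v.
Proof. by rewrite !mxE; apply: eq_bigr => j _; rewrite !mxE. Qed.

(** From here on the system matrix is seen only through this bilinear form: damping, a positive
    semidefinite Gauss-Newton part, and a curvature part of no definite sign. *)
Lemma sysmat_form g th v w :
  (v *m sysmat g (loss beta sigma x y) th *m w^T) 0 0 = g * dotv v w +
  M%:R^-1 * \sum_(m < M) (dnet (x m) th v * dnet (x m) th w +
                          resid th m * ddnet (x m) th v w).
Proof.
rewrite /sysmat mulmxDr mulmxDl mxE hess_form; congr (_ + _).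
by rewrite mul_mx_scalar -scalemxAl mxE dotvE.
Qed.

End Network.

(** * Elementary bounds for finite sums *)

Section FiniteSums.
Variable R : realType.
Implicit Types a b A B : R.

Lemma normM_le a b A B : `|a| <= A -> `|b| <= B -> `|a * b| <= A * B.
Proof. by move=> aA bB; rewrite normrM ler_pM. Qed.

Lemma normD_le a b A B : `|a| <= A -> `|b| <= B -> `|a + b| <= A + B.
Proof. by move=> aA bB; rewrite (le_trans (ler_normD _ _))// lerD. Qed.

Lemma norm_sum_le n (F : 'I_n -> R) A : (forall i, `|F i| <= A) ->
  `|\sum_(i < n) F i| <= n%:R * A.
Proof.
move=> FA; rewrite (le_trans (ler_norm_sum _ _ _))//.
rewrite (le_trans (ler_sum _ (fun i _ => FA i)))//.
by rewrite sumr_const card_ord mulr_natl.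
Qed.

Lemma norm_mean_le n (F : 'I_n -> R) A : (0 < n)%N -> (forall i, `|F i| <= A) ->
  `|n%:R^-1 * \sum_(i < n) F i| <= A.
Proof.
move=> n0 /norm_sum_le FA; rewrite normrM normfV normr_nat.
by rewrite ler_pdivrMl// ltr0n.
Qed.

Lemma le_sqr_norm a A : 0 <= A -> a ^+ 2 <= A ^+ 2 -> `|a| <= A.
Proof.
by move=> A0 aA; rewrite -ler_sqr ?nnegrE// real_normK ?num_real.
Qed.

Lemma sqr_le_sum n (F : 'I_n -> R) i : F i ^+ 2 <= \sum_(j < n) F j ^+ 2.
Proof. by rewrite (bigD1 i)//= lerDl sumr_ge0// => j _; exact: sqr_ge0. Qed.

(** The factor [n] in place of its square root avoids radicals; it is applied with [n = M], on which
    the constants may depend. *)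
Lemma norm_le_of_sumsq n (F G : 'I_n -> R) A : (0 < n)%N -> 0 <= A ->
  \sum_(j < n) F j ^+ 2 <= \sum_(j < n) G j ^+ 2 ->
  (forall j, `|G j| <= A) -> forall j, `|F j| <= n%:R * A.
Proof.
move=> n0 A0 FG GA j; apply: le_sqr_norm; first by rewrite mulr_ge0.
apply: (le_trans (sqr_le_sum F j)); apply: (le_trans FG).
apply: (@le_trans _ _ (n%:R * A ^+ 2)).
  rewrite mulr_natl -[n in _ *+ n]card_ord -sumr_const; apply: ler_sum => i _.
  by rewrite -real_normK ?num_real// ler_sqr ?nnegrE.
rewrite exprMn ler_wpM2r ?sqr_ge0// expr2 ler_peMl ?ler0n//.
by rewrite ler1n.
Qed.

(* Completing the square: [s (s - r) <= 0] gives [s ^ 2 <= r ^ 2] after summation. *)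
Lemma sumsq_le n (S r : 'I_n -> R) :
  \sum_(j < n) S j * (S j - r j) <= 0 ->
  \sum_(j < n) S j ^+ 2 <= \sum_(j < n) r j ^+ 2.
Proof.
move=> Sr; rewrite -subr_ge0 -sumrB.
apply: (@le_trans _ _ (- (2 * \sum_(j < n) S j * (S j - r j)))).
  by rewrite oppr_ge0 pmulr_rle0.
rewrite mulr_sumr -sumrN; apply: ler_sum => j _.
by rewrite -subr_ge0 (_ : _ - _ = (S j - r j) ^+ 2) ?sqr_ge0//; ring.
Qed.

End FiniteSums.

(** * Blocks of the parameter vector and test vectors *)

Section ParameterVectors.
Variables (R : realType) (N d : nat).
Notation V := 'rV[R]_(N * d.+2).

(** A right inverse of the readers [cof], [wofth] and [etaofth]: removing column 0 and then the last
    column with [unlift] leaves exactly the columns of the inner weights. *)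
Definition mkparam (f : 'I_N -> R) (g : 'I_N -> 'I_d -> R) (e : 'I_N -> R) : V :=
  mxvec (\matrix_(i, j) if unlift ord0 j is Some k then
    (if unlift ord_max k is Some l then g i l else e i) else f i).

Lemma widen_lift (l : 'I_d) : widen_ord (leqnSn d) l = lift ord_max l.
Proof. by apply/val_inj => /=; rewrite /bump leqNgt ltn_ord. Qed.

Lemma lift0_max : lift ord0 ord_max = ord_max :> 'I_d.+2.
Proof. exact/val_inj. Qed.

Lemma cof_mkparam f g e i : cof (mkparam f g e) i = f i.
Proof. by rewrite /cof mxvecK mxE unlift_none. Qed.

Lemma wofth_mkparam f g e i l : wofth (mkparam f g e) i l = g i l.
Proof. by rewrite /wofth mxvecK mxE liftK widen_lift liftK. Qed.

Lemma etaofth_mkparam f g e i : etaofth (mkparam f g e) i = e i.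
Proof. by rewrite /etaofth mxvecK mxE -lift0_max liftK unlift_none. Qed.

Lemma dotv_split (v w : V) : dotv v w = \sum_(i < N) (cof v i * cof w i +
  (\sum_(l < d) wofth v i l * wofth w i l + etaofth v i * etaofth w i)).
Proof.
rewrite /dotv (reindex _ (curry_mxvec_bij _ _))/=.
transitivity (\sum_(i < N) \sum_(j < d.+2)
    v 0 (mxvec_index i j) * w 0 (mxvec_index i j)).
  by rewrite pair_bigA; apply: eq_bigr => -[].
apply: eq_bigr => i _; rewrite big_ord_recl big_ord_recr /=.
by rewrite lift0_max /cof /wofth /etaofth !mxE; congr (_ + (_ + _));
   apply: eq_bigr => l _; rewrite !mxE.
Qed.

(** Squared Euclidean norm of the block of neuron [i]. A bound on the whole vector would not
    suffice: each neuron separately has to stay close to its starting point. *)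
Definition nsq (v : V) i : R :=
  cof v i ^+ 2 + (\sum_(l < d) wofth v i l ^+ 2 + etaofth v i ^+ 2).
Definition nrm v i := Num.sqrt (nsq v i).

Lemma nsq_ge0 v i : 0 <= nsq v i.
Proof. by rewrite !addr_ge0 ?sqr_ge0// sumr_ge0// => l _; rewrite sqr_ge0. Qed.

Lemma nrm_sqr v i : nrm v i ^+ 2 = nsq v i.
Proof. by rewrite sqr_sqrtr ?nsq_ge0. Qed.

Lemma nrm_ge0 v i : 0 <= nrm v i. Proof. exact: sqrtr_ge0. Qed.

Lemma dotvv v : dotv v v = \sum_(i < N) nrm v i ^+ 2.
Proof.
rewrite dotv_split; apply: eq_bigr => i _; rewrite nrm_sqr /nsq !expr2.
by congr (_ + (_ + _)); apply: eq_bigr => l _; rewrite expr2.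
Qed.

Lemma norm_cof v i : `|cof v i| <= nrm v i.
Proof.
apply: le_sqr_norm; rewrite ?nrm_ge0// nrm_sqr /nsq lerDl.
by rewrite addr_ge0 ?sqr_ge0// sumr_ge0// => l _; rewrite sqr_ge0.
Qed.

Lemma norm_etaofth v i : `|etaofth v i| <= nrm v i.
Proof.
apply: le_sqr_norm; rewrite ?nrm_ge0// nrm_sqr /nsq addrA lerDr.
by rewrite addr_ge0 ?sqr_ge0// sumr_ge0// => l _; rewrite sqr_ge0.
Qed.

Lemma norm_wofth v i l : `|wofth v i l| <= nrm v i.
Proof.
apply: le_sqr_norm; rewrite ?nrm_ge0// nrm_sqr /nsq.
rewrite (le_trans (sqr_le_sum (fun l => wofth v i l) l))//.
by rewrite addrCA lerDl addr_ge0 ?sqr_ge0.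
Qed.

Lemma norm_preact (xx : 'rV[R]_d) G v i : (forall j, `|xx 0 j| <= G) ->
  `|preact xx v i| <= (d%:R * G + 1) * nrm v i.
Proof.
move=> xG; rewrite mulrDl mul1r; apply: normD_le; last exact: norm_etaofth.
rewrite -mulrA; apply: norm_sum_le => l; rewrite mulrC.
by apply: normM_le => //; exact: norm_wofth.
Qed.

Definition block (z : V) (i : 'I_N) : V := mkparam
  (fun k => if k == i then cof z k else 0)
  (fun k l => if k == i then wofth z k l else 0)
  (fun k => if k == i then etaofth z k else 0).

Lemma cof_block z i k : cof (block z i) k = if k == i then cof z k else 0.
Proof. exact: cof_mkparam. Qed.

Lemma preact_block (xx : 'rV[R]_d) z i k :
  preact xx (block z i) k = if k == i then preact xx z k else 0.
Proof.
rewrite /preact etaofth_mkparam; under eq_bigr do rewrite wofth_mkparam.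
by case: eqP => // _; rewrite addr0 big1// => l _; rewrite mul0r.
Qed.

Lemma sum_if_eq n (i : 'I_n) (F : 'I_n -> R) :
  \sum_(k < n) (if k == i then F k else 0) = F i.
Proof. by rewrite -big_mkcond big_pred1_eq. Qed.

Lemma dotv_block z i : dotv (block z i) z = nrm z i ^+ 2.
Proof.
rewrite dotv_split nrm_sqr -(sum_if_eq i (fun k => nsq z k)).
apply: eq_bigr => k _; rewrite cof_mkparam etaofth_mkparam.
under eq_bigr do rewrite wofth_mkparam.
rewrite /nsq; case: eqP => _; last first.
  by rewrite !mul0r add0r addr0 big1// => l _; rewrite mul0r.
by rewrite !expr2; congr (_ + (_ + _)); apply: eq_bigr => l _; rewrite expr2.
Qed.

Variables (sigma : R -> R) (beta : R).

Lemma dnet_block (xx : 'rV[R]_d) (th : V) z i : dnet sigma beta xx th (block z i) =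
  N%:R `^ (- beta) * (cof z i * sigma (preact xx th i) +
    cof th i * derive1 sigma (preact xx th i) * preact xx z i).
Proof.
rewrite /dnet -(sum_if_eq i (fun i => cof z i * sigma (preact xx th i) +
    cof th i * derive1 sigma (preact xx th i) * preact xx z i)).
congr (_ * _); apply: eq_bigr => k _; rewrite cof_block preact_block.
by case: eqP => // _; rewrite mul0r mulr0 addr0.
Qed.

Lemma ddnet_block (xx : 'rV[R]_d) (th : V) z i : ddnet sigma beta xx th (block z i) z =
  N%:R `^ (- beta) * ddnet_at sigma xx th z z i.
Proof.
rewrite /ddnet -(sum_if_eq i (fun i => ddnet_at sigma xx th z z i)).
congr (_ * _); apply: eq_bigr => k _; rewrite /ddnet_at cof_block preact_block.
by case: eqP => // _; rewrite !(mul0r, mulr0, addr0).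
Qed.

(** The gradient of the output at [xx] with respect to the parameters, that is, the vector
    representing [dnet] for [dotv]. *)
Definition gradvec (xx : 'rV[R]_d) (th : V) : V := mkparam
  (fun i => N%:R `^ (- beta) * sigma (preact xx th i))
  (fun i l => N%:R `^ (- beta) *
     (cof th i * derive1 sigma (preact xx th i) * xx 0 l))
  (fun i => N%:R `^ (- beta) * (cof th i * derive1 sigma (preact xx th i))).

Lemma preact_gradvec (xx xx' : 'rV[R]_d) (th : V) i : preact xx' (gradvec xx th) i =
  N%:R `^ (- beta) * (cof th i * derive1 sigma (preact xx th i) *
                      (dotv xx xx' + 1)).
Proof.
rewrite {1}/preact etaofth_mkparam mulrDr mulr1 mulrDr; congr (_ + _).
rewrite /dotv !mulr_sumr; apply: eq_bigr => l _.
by rewrite wofth_mkparam; ring.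
Qed.

Lemma dotv_gradvec (xx : 'rV[R]_d) (th : V) v : dotv (gradvec xx th) v = dnet sigma beta xx th v.
Proof.
rewrite dotv_split /dnet mulr_sumr; apply: eq_bigr => i _.
rewrite cof_mkparam etaofth_mkparam [preact xx v i]/preact.
under eq_bigr do rewrite wofth_mkparam.
rewrite [RHS]mulrDr; congr (_ + _); first by ring.
rewrite [in RHS]mulrDr [RHS]mulrDr; congr (_ + _); last by ring.
by rewrite !mulr_sumr; apply: eq_bigr => l _; ring.
Qed.

End ParameterVectors.

(** * Estimates for one Levenberg-Marquardt step *)

Section LevenbergMarquardtStep.
Variable R : realType.

(** The neural tangent kernel of a single neuron: the inner product of the gradients of
    [c * sigma (w . x + eta)] at two inputs. The [+ 1] next to [dotv xm xn] is the bias
    coordinate. *)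
Definition kern d (sigma : R -> R) (xm xn : 'rV[R]_d) (c um un : R) : R :=
  sigma um * sigma un +
  c ^+ 2 * derive1 sigma um * derive1 sigma un * (dotv xm xn + 1).

Definition empirical_kernel N d M sigma (x : 'I_M -> 'rV[R]_d)
    (th : 'rV[R]_(N * d.+2)) (m n : 'I_M) : R :=
  M%:R^-1 * (N%:R^-1 * \sum_(i < N) kern sigma (x m) (x n) (cof th i)
    (preact (x m) th i) (preact (x n) th i)).

Definition bounded_activation (sigma : R -> R) (G : R) : Prop :=
  [/\ (forall t, derivable sigma t 1), (forall t, derivable (derive1 sigma) t 1),
      (forall t, `|sigma t| <= G), (forall t, `|derive1 sigma t| <= G) &
      (forall t, `|derive1n 2 sigma t| <= G)] /\
  (Defs.lipschitz sigma G /\ Defs.lipschitz (derive1 sigma) G).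

Lemma powR_scales (N : nat) (beta gam : R) : (0 < N)%N ->
  let s := N%:R `^ (- beta) in let h := N%:R `^ (- (1 - beta)) in
  [/\ 0 < s, 0 < h, N%:R * s * h = 1 &
      gam / N%:R `^ (2 * beta - 1) = gam * s / h].
Proof.
move=> N0 s h; have NR : 0 < N%:R :> R by rewrite ltr0n.
have N1 : N%:R != 0 :> R by rewrite gt_eqF.
split; rewrite ?powR_gt0//.
  rewrite -[X in X * s]powRr1 ?ler0n// -!powRD ?N1 ?implybT//.
  by rewrite (_ : _ + _ = 0) ?powRr0//; ring.
rewrite -!mulrA; congr (_ * _); rewrite -!powRN -powRD ?N1 ?implybT//.
by congr (_ `^ _); ring.
Qed.

Lemma mean_value (sigma : R -> R) (u v : R) : (forall t, derivable sigma t 1) ->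
  exists c, `|c - u| <= `|v| /\ sigma (v + u) - sigma u = derive1 sigma c * v.
Proof.
move=> ds.
have ids (t : R) : is_derive t 1 sigma (derive1 sigma t).
  by rewrite derive1E; apply/derivableP.
have cs (A : set R) : {within A, continuous sigma}.
  apply: continuous_subspaceT => t.
  exact/differentiable_continuous/derivable1_diffP.
have [v0|v0|->] := ltgtP v 0.
- have [|c cI e] := @MVT _ sigma (derive1 sigma) (v + u) u _ (fun t _ => ids t) (cs _).
    by rewrite gtrDr.
  exists c; split; last by rewrite -opprB e; ring.
  move: cI; rewrite in_itv/= => /andP[c1 c2].
  by rewrite (ltr0_norm v0) ler0_norm; lra.
- have [|c cI e] := @MVT _ sigma (derive1 sigma) u (v + u) _ (fun t _ => ids t) (cs _).
    by rewrite ltrDr.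
  exists c; split; last by rewrite e; ring.
  move: cI; rewrite in_itv/= => /andP[c1 c2].
  by rewrite (gtr0_norm v0) ger0_norm; lra.
- by exists u; rewrite add0r !subrr normr0 mulr0.
Qed.

(** The mean value point lies within [|v|] of [u], so the Lipschitz bound on the derivative supplies
    the second factor [|v|]. *)
Lemma taylor2 (sigma : R -> R) (G u v : R) : (forall t, derivable sigma t 1) ->
  Defs.lipschitz (derive1 sigma) G ->
  `|sigma (v + u) - sigma u - derive1 sigma u * v| <= `|G| * `|v| ^+ 2.
Proof.
move=> ds lip; have [c [cu ->]] := mean_value u v ds.
rewrite -mulrBl expr2 mulrA; apply: normM_le => //.
rewrite (le_trans (lip _ _))// (le_trans (ler_wpM2r _ (ler_norm G)))//.
by rewrite ler_wpM2l.
Qed.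

Variables (N d M : nat) (sigma : R -> R) (beta : R).
Variables (x : 'I_M -> 'rV[R]_d) (y : 'I_M -> R).
Variables (th : 'rV[R]_(N * d.+2)) (G Q gam : R).
Hypotheses (N0 : (0 < N)%N) (M0 : (0 < M)%N).
Hypotheses (G1 : 1 <= G) (Q1 : 1 <= Q) (gam0 : 0 < gam).
Hypothesis sigmaG : bounded_activation sigma G.
Hypothesis xG : forall m j, `|x m 0 j| <= G.
Let resid m := fnet beta sigma th (x m) - y m.
Hypothesis residQ : forall m, `|resid m| <= Q.
Hypothesis cofQ : forall i, `|cof th i| <= Q.

Let s := N%:R `^ (- beta).
Let h := N%:R `^ (- (1 - beta)).
Let gN := gam / N%:R `^ (2 * beta - 1).
(** [K] compares a preactivation with the norm of its block, and [H] is the resulting bound for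
    [ddnet_at] relative to the squared block norm. Since [gN = gam * s / h], the assumption [gamh]
    is equivalent to [Q * (s * H) <= gN / 2]; it is the source of [Cgamma]. *)
Let K := d%:R * G + 1.
Let H := G * K * (2 + Q * K).
Hypothesis gamh : 2 * Q * H * h <= gam.

Let L : 'rV[R]_(N * d.+2) -> R := loss beta sigma x y.
Let S := sysmat gN L th.

Let s0 : 0 < s. Proof. by have [] := powR_scales beta gam N0. Qed.
Let h0 : 0 < h. Proof. by have [] := powR_scales beta gam N0. Qed.
Let Nsh : N%:R * s * h = 1. Proof. by have [] := powR_scales beta gam N0. Qed.
Let gNE : gN = gam * s / h. Proof. by have [] := powR_scales beta gam N0. Qed.
Let gN0 : 0 < gN. Proof. by rewrite gNE divr_gt0// mulr_gt0. Qed.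
Let G0 : 0 <= G. Proof. exact: le_trans ler01 G1. Qed.
Let Q0 : 0 <= Q. Proof. exact: le_trans ler01 Q1. Qed.
Let K1 : 1 <= K. Proof. by rewrite /K lerDr mulr_ge0. Qed.
Let K0 : 0 <= K. Proof. exact: le_trans ler01 K1. Qed.
Let H0 : 0 <= H. Proof. by rewrite /H !(mulr_ge0, addr_ge0). Qed.
Let M0R : 0 < M%:R :> R. Proof. by rewrite ltr0n. Qed.
Let N0R : 0 < N%:R :> R. Proof. by rewrite ltr0n. Qed.

Let dsigma : forall t, derivable sigma t 1. Proof. by case: sigmaG => -[]. Qed.
Let ddsigma : forall t, derivable (derive1 sigma) t 1.
Proof. by case: sigmaG => -[]. Qed.
Let sG t : `|sigma t| <= G. Proof. by case: sigmaG => -[]. Qed.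
Let s'G t : `|derive1 sigma t| <= G. Proof. by case: sigmaG => -[]. Qed.
Let s''G t : `|derive1n 2 sigma t| <= G. Proof. by case: sigmaG => -[]. Qed.

Let preactK m (v : 'rV[R]_(N * d.+2)) i : `|preact (x m) v i| <= K * nrm v i.
Proof. exact: norm_preact. Qed.

Let ddnet_atH m (v : 'rV[R]_(N * d.+2)) i : `|ddnet_at sigma (x m) th v v i| <= H * nrm v i ^+ 2.
Proof.
rewrite (_ : H * _ = nrm v i * G * (K * nrm v i) + nrm v i * G * (K * nrm v i) +
  Q * G * (K * nrm v i) * (K * nrm v i)); last by rewrite /H; ring.
apply: normD_le; [apply: normD_le|]; repeat (apply: normM_le => //);
  exact: norm_cof.
Qed.

Let curvature_coef : Q * (s * H) <= gN / 2.
Proof.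
rewrite gNE (_ : gam * s / h / 2 = s * (gam / (2 * h))); last by field; rewrite gt_eqF.
rewrite (_ : Q * (s * H) = s * (Q * H)); last by ring.
rewrite ler_pM2l// ler_pdivlMr ?mulr_gt0//.
by rewrite (_ : Q * H * (2 * h) = 2 * Q * H * h)//; ring.
Qed.

Lemma curvature_le (v : 'rV[R]_(N * d.+2)) : M%:R^-1 * \sum_(m < M) `|resid m * ddnet sigma beta (x m) th v v| <=
  gN / 2 * dotv v v.
Proof.
rewrite ler_pdivrMl//; apply: (@le_trans _ _ (M%:R * (Q * (s * H * dotv v v)))).
  rewrite mulr_natl -[M in _ *+ M]card_ord -sumr_const; apply: ler_sum => m _.
  apply: normM_le => //; rewrite /ddnet normrM (gtr0_norm s0) -mulrA.
  rewrite ler_pM2l// dotvv mulr_sumr (le_trans (ler_norm_sum _ _ _))//.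
  exact: ler_sum.
rewrite ler_pM2l// (_ : Q * _ = Q * (s * H) * dotv v v); last by ring.
rewrite ler_wpM2r ?curvature_coef//.
by rewrite dotvv sumr_ge0// => i _; rewrite sqr_ge0.
Qed.

Let curvature_ge (v : 'rV[R]_(N * d.+2)) : - (gN / 2 * dotv v v) <=
  M%:R^-1 * \sum_(m < M) resid m * ddnet sigma beta (x m) th v v.
Proof.
rewrite lerNl (le_trans _ (curvature_le v))// -mulrN ler_pM2l ?invr_gt0//.
rewrite -sumrN; apply: ler_sum => m _.
by rewrite -normrN ler_norm.
Qed.

(** For a null vector [v] the form would give [gN |v|^2 + A + B = 0], where the Gauss-Newton part
    [A] is nonnegative and the curvature part [B] is at least [- gN |v|^2 / 2]. *)
Lemma sysmat_unit : S \in unitmx.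
Proof.
rewrite unitmxE unitfE; apply/negP => /det0P[v v0 vS].
have vv : 0 < dotv v v.
  have vv0 : 0 <= dotv v v.
    by rewrite dotvv sumr_ge0// => i _; rewrite sqr_ge0.
  rewrite lt_neqAle vv0 andbT eq_sym; apply: contra v0 => /eqP vv.
  apply/eqP/rowP => j; rewrite mxE; apply/eqP.
  have : v 0 j ^+ 2 <= dotv v v.
    rewrite /dotv; under eq_bigr do rewrite -expr2.
    exact: (sqr_le_sum (fun j => v 0 j)).
  by rewrite vv => /(conj (sqr_ge0 (v 0 j)))/andP/le_anti/esym/eqP; rewrite sqrf_eq0.
pose A := M%:R^-1 * \sum_(m < M)
  dnet sigma beta (x m) th v * dnet sigma beta (x m) th v.
pose B := M%:R^-1 * \sum_(m < M) resid m * ddnet sigma beta (x m) th v v.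
have E : gN * dotv v v + (A + B) = 0.
  have := sysmat_form beta dsigma ddsigma x y M0 gN th v v.
  by rewrite -/L -/S vS mul0mx mxE => /esym; rewrite big_split/= mulrDr.
have A0 : 0 <= A.
  by rewrite mulr_ge0 ?invr_ge0// sumr_ge0// => m _; rewrite -expr2 sqr_ge0.
have := le_trans (curvature_ge v) (lexx B).
have := mulr_gt0 gN0 vv.
lra.
Qed.

Definition lm_direction : 'rV[R]_(N * d.+2) := - (invmx S *m (gradv L th)^T)^T.
Let z := lm_direction.

Lemma lmstepE alpha : lmstep alpha gN L th = alpha *: z + th.
Proof. by rewrite /lmstep linearN addrC. Qed.

Definition predicted_resid m := dnet sigma beta (x m) th z + resid m.
Let P := predicted_resid.

(** The Gauss-Newton term and the gradient of the loss share the factor [dnet v], so they merge into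
    a single sum weighted by the predicted residual. *)
Lemma lm_weak_form v : gN * dotv v z +
  M%:R^-1 * \sum_(m < M) P m * dnet sigma beta (x m) th v +
  M%:R^-1 * \sum_(m < M) resid m * ddnet sigma beta (x m) th v z = 0.
Proof.
have Sz : (v *m S *m z^T) 0 0 = - (v *m (gradv L th)^T) 0 0.
  by rewrite /z /lm_direction linearN /= trmxK mulmxN mulmxA mulmxK ?sysmat_unit// mxE.
move: Sz; rewrite (sysmat_form beta dsigma ddsigma x y M0).
rewrite (grad_form beta dsigma x y M0) => /eqP; rewrite -addr_eq0 => /eqP E.
apply: etrans E; rewrite -!addrA; congr (_ + _); rewrite -!mulrDr -!big_split /=; congr (_ * _).
by apply: eq_bigr => m _; rewrite /P /predicted_resid /resid; ring.
Qed.

(** With [v = z] the damping absorbs the curvature, and [dnet z = P - resid] leaves the sum of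
    [P (P - resid)] nonpositive, so [P] is no larger than the residual in the Euclidean norm. *)
Lemma predicted_resid_le m : `|P m| <= M%:R * Q.
Proof.
apply: (@norm_le_of_sumsq _ _ P resid) => //; apply: sumsq_le.
have E := lm_weak_form z; have C := curvature_ge z.
have zz : 0 <= gN * dotv z z.
  by rewrite mulr_ge0 ?(ltW gN0)// dotvv sumr_ge0// => i _; rewrite sqr_ge0.
have : M%:R^-1 * \sum_(m < M) P m * dnet sigma beta (x m) th z <= 0 by lra.
rewrite pmulr_rle0 ?invr_gt0//; apply: le_trans; apply: ler_sum => k _.
by rewrite /P /predicted_resid addrK.
Qed.

Let Z := 2 * (M%:R * Q * (G + Q * G * K)) / gam.

(** On one block the curvature is quadratic in [nrm z i] and is absorbed by half of the damping.
    What remains is [gN / 2 * p ^ 2 <= O(s) * p] for [p = nrm z i]; dividing by [p] and inserting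
    [gN = gam * s / h] cancels [s]. *)
Lemma lm_direction_le i : nrm z i <= Z * h.
Proof.
have E := lm_weak_form (block z i); rewrite dotv_block in E.
have p0 := nrm_ge0 z i.
have E1 : `|M%:R^-1 * \sum_(m < M) P m * dnet sigma beta (x m) th (block z i)| <=
    M%:R * Q * (s * ((G + Q * G * K) * nrm z i)).
  apply: norm_mean_le => // m; apply: normM_le; first exact: predicted_resid_le.
  rewrite dnet_block normrM (gtr0_norm s0) ler_pM2l// mulrDl.
  apply: normD_le; first by rewrite [G * _]mulrC; apply: normM_le => //; exact: norm_cof.
  by rewrite -[Q * G * K * _]mulrA; apply: normM_le => //; apply: normM_le.
have E2 : `|M%:R^-1 * \sum_(m < M) resid m * ddnet sigma beta (x m) th (block z i) z| <=
    Q * (s * (H * nrm z i ^+ 2)).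
  apply: norm_mean_le => // m; apply: normM_le => //.
  by rewrite ddnet_block normrM (gtr0_norm s0) ler_pM2l.
have E3 : Q * (s * (H * nrm z i ^+ 2)) <= gN / 2 * nrm z i ^+ 2.
  rewrite (_ : Q * _ = Q * (s * H) * nrm z i ^+ 2); last by ring.
  by rewrite ler_wpM2r ?sqr_ge0.
have : gN / 2 * nrm z i ^+ 2 <= M%:R * Q * (s * ((G + Q * G * K) * nrm z i)).
  move: E1 E2; rewrite !ler_norml => /andP[? ?] /andP[? ?]; lra.
have [->|pne] := eqVneq (nrm z i) 0.
  by rewrite mulr_ge0 ?(ltW h0)// divr_ge0 ?(ltW gam0)// !(mulr_ge0, addr_ge0).
have pp : 0 < nrm z i by rewrite lt_neqAle eq_sym pne.
rewrite (_ : _ * (s * _) = M%:R * Q * s * (G + Q * G * K) * nrm z i); last by ring.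
rewrite expr2 mulrA ler_pM2r// gNE => F.
rewrite /Z mulrAC ler_pdivlMr// -(ler_pM2l (_ : 0 < s / h / 2)); last first.
  by rewrite !divr_gt0.
apply: le_trans (le_trans _ F) _; first by rewrite le_eqVlt; apply/orP; left; apply/eqP; field; rewrite gt_eqF.
by rewrite le_eqVlt; apply/orP; left; apply/eqP; field; rewrite gt_eqF.
Qed.

Let K2 := d%:R * G ^+ 2 + 1.
Let K20 : 0 <= K2. Proof. by rewrite /K2 addr_ge0 ?mulr_ge0 ?sqr_ge0. Qed.

Let dotK2 m n : `|dotv (x m) (x n) + 1| <= K2.
Proof.
apply: normD_le; last by rewrite normr1.
by apply: norm_sum_le => j; rewrite expr2; apply: normM_le.
Qed.

Let Z0 : 0 <= Z.
Proof. by rewrite divr_ge0 ?(ltW gam0)// !(mulr_ge0, addr_ge0). Qed.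

Let cofZ i : `|cof z i| <= Z * h.
Proof. exact: le_trans (norm_cof _ _) (lm_direction_le i). Qed.

Let preactZ m i : `|preact (x m) z i| <= K * Z * h.
Proof.
by rewrite (le_trans (preactK _ _ _))// -mulrA ler_wpM2l ?lm_direction_le.
Qed.

Lemma dnet_gradvec m n :
  dnet sigma beta (x m) th (gradvec sigma beta (x n) th) =
  s ^+ 2 * N%:R * M%:R * empirical_kernel sigma x th n m.
Proof.
rewrite (_ : _ * empirical_kernel _ _ _ _ _ = s ^+ 2 * \sum_(i < N)
  kern sigma (x n) (x m) (cof th i) (preact (x n) th i) (preact (x m) th i)); last first.
  by rewrite /empirical_kernel; field; rewrite !gt_eqF.
rewrite /dnet expr2 -mulrA; congr (_ * _); rewrite mulr_sumr.
apply: eq_bigr => i _; rewrite cof_mkparam preact_gradvec /kern -/s.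
by ring.
Qed.

(** The three terms bound those of [ddnet_at]: a block of [gradvec] has size [O(s)] and one of [z]
    size [O(h)], and summing over the neurons uses [N s h = 1]. *)
Let C4 := G * G * (K * Z) + Z * G * (Q * G * K2) +
  Q * G * (Q * G * K2) * (K * Z).

Let ddnet_gradvec m n :
  `|ddnet sigma beta (x m) th (gradvec sigma beta (x n) th) z| <= s * C4.
Proof.
rewrite /ddnet normrM (gtr0_norm s0) ler_pM2l//.
rewrite (_ : C4 = N%:R * (s * h * C4)); last first.
  by rewrite !mulrA Nsh mul1r.
apply: norm_sum_le => i; rewrite (_ : s * h * C4 =
  s * G * G * (K * Z * h) + Z * h * G * (s * (Q * G * K2)) +
  Q * G * (s * (Q * G * K2)) * (K * Z * h)); last by rewrite /C4; ring.
have gp : `|preact (x m) (gradvec sigma beta (x n) th) i| <= s * (Q * G * K2).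
  rewrite preact_gradvec normrM (gtr0_norm s0) ler_pM2l//.
  by apply: normM_le => //; apply: normM_le.
have gc : `|cof (gradvec sigma beta (x n) th) i| <= s * G.
  by rewrite cof_mkparam normrM (gtr0_norm s0) ler_pM2l.
by apply: normD_le; [apply: normD_le|]; repeat (apply: normM_le => //).
Qed.

(** The weak form tested with [gradvec] is multiplied by [h / s]: the damping coefficient becomes
    [gam], the factor [s ^ 2 * N] of the kernel becomes 1, and the curvature term drops from [O(s)]
    to [O(h)]. *)
Lemma predicted_resid_eq n :
  `|gam * (P n - resid n) + \sum_(m < M) empirical_kernel sigma x th n m * P m| <=
  Q * C4 * h.
Proof.
have := lm_weak_form (gradvec sigma beta (x n) th); rewrite dotv_gradvec.
set D := M%:R^-1 * \sum_(m < M) resid m * _ => E.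
have DC : `|D| <= Q * (s * C4).
  by apply: norm_mean_le => // m; apply: normM_le.
rewrite (_ : gam * _ + _ = - (h / s) * D); last first.
  have -> : D = - (gN * dnet sigma beta (x n) th z + s ^+ 2 * N%:R *
      \sum_(m < M) empirical_kernel sigma x th n m * P m).
    apply/eqP; rewrite -addr_eq0 addrC -[X in _ == X]E; apply/eqP.
    congr (_ + _ + _); rewrite !mulr_sumr; apply: eq_bigr => m _.
    by rewrite dnet_gradvec; field; rewrite gt_eqF.
  rewrite /P /predicted_resid addrK gNE.
  set X := \sum_(m < M) _.
  transitivity (gam * dnet sigma beta (x n) th z + N%:R * s * h * X).
    by rewrite Nsh mul1r.
  by field; rewrite !gt_eqF.
rewrite normrM normrN (ger0_norm (divr_ge0 (ltW h0) (ltW s0))).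
apply: (le_trans (ler_wpM2l (divr_ge0 (ltW h0) (ltW s0)) DC)).
by rewrite le_eqVlt; apply/orP; left; apply/eqP; field; rewrite gt_eqF.
Qed.

Variable alpha : R.
Hypothesis alpha0 : 0 < alpha.
Hypothesis h1 : h <= 1.
Let th' := lmstep alpha gN L th.
Let D := alpha * (K * Z).

Let D0 : 0 <= D.
Proof. by rewrite mulr_ge0 ?(ltW alpha0)// mulr_ge0. Qed.

Let cof_step i : cof th' i = alpha * cof z i + cof th i.
Proof. by rewrite /th' lmstepE cof_lin. Qed.

Let preact_step m i : preact (x m) th' i = alpha * preact (x m) z i + preact (x m) th i.
Proof. by rewrite /th' lmstepE preact_lin. Qed.

Let dcof i : `|alpha * cof z i| <= D * h.
Proof.
rewrite normrM (gtr0_norm alpha0) -mulrA ler_pM2l// (le_trans (cofZ i))//.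
by rewrite -mulrA ler_peMl// mulr_ge0// (ltW h0).
Qed.

Let dpreact m i : `|alpha * preact (x m) z i| <= D * h.
Proof. by rewrite normrM (gtr0_norm alpha0) -mulrA ler_pM2l. Qed.

Lemma cof_step_le i : `|cof th' i| <= D + Q.
Proof.
rewrite cof_step; apply: normD_le => //; rewrite (le_trans (dcof i))//.
by rewrite ler_piMr.
Qed.

Let C5 := Q * (G * D ^+ 2) + D * (G * D).

(** Each neuron contributes a Taylor remainder of [sigma] and a product of two increments, both
    [O(h ^ 2)]; the weighted sum over all neurons costs [N s], which is the inverse of [h]. *)
Lemma fnet_step m : `|fnet beta sigma th' (x m) - fnet beta sigma th (x m) -
  alpha * dnet sigma beta (x m) th z| <= C5 * h.
Proof.
rewrite /fnet /dnet -/s -mulrBr mulrCA -mulrBr normrM (gtr0_norm s0).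
rewrite mulr_sumr -!sumrB.
rewrite (_ : C5 * h = s * (N%:R * (C5 * h ^+ 2))); last first.
  rewrite (_ : s * _ = N%:R * s * h * (C5 * h)); last by ring.
  by rewrite Nsh mul1r.
rewrite ler_pM2l//; apply: norm_sum_le => i; rewrite -!/(preact _ _ _).
rewrite cof_step preact_step.
rewrite (_ : _ - _ - _ = cof th i * (sigma (alpha * preact (x m) z i + preact (x m) th i)
   - sigma (preact (x m) th i) -
     derive1 sigma (preact (x m) th i) * (alpha * preact (x m) z i)) +
  alpha * cof z i * (sigma (alpha * preact (x m) z i + preact (x m) th i) -
    sigma (preact (x m) th i))); last by ring.
rewrite (_ : C5 * h ^+ 2 = Q * (G * (D * h) ^+ 2) + D * h * (G * (D * h))); last first.
  by rewrite /C5; ring.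
have [_ [lip lip']] := sigmaG.
apply: normD_le; apply: normM_le => //.
  rewrite (le_trans (taylor2 _ _ _ lip'))// (ger0_norm G0) ler_wpM2l//.
  by rewrite ler_pXn2r ?nnegrE// mulr_ge0// (ltW h0).
by rewrite (le_trans (lip _ _))// addrK ler_wpM2l.
Qed.

Let C6 := G * D * G + G * (G * D) + (D * (D + 2 * Q) * G * G +
  Q ^+ 2 * (G * D) * G + Q ^+ 2 * G * (G * D)) * K2.

Lemma kernel_step m n : `|empirical_kernel sigma x th' m n -
  empirical_kernel sigma x th m n| <= C6 * h.
Proof.
rewrite /empirical_kernel -mulrBr -mulrBr -sumrB normrM normfV normr_nat.
rewrite ler_pdivrMl//; apply: (@le_trans _ _ (C6 * h)); last first.
  rewrite ler_peMl ?ler1n//.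
  apply: mulr_ge0; last exact: ltW.
  rewrite /C6; repeat (first [done|apply: addr_ge0|apply: sqr_ge0|apply: mulr_ge0]).
apply: norm_mean_le => // i; rewrite cof_step !preact_step.
have [_ [lip lip']] := sigmaG.
set a := alpha * cof z i; set b := alpha * preact (x m) z i.
set e := alpha * preact (x n) z i.
set u := preact (x m) th i; set v := preact (x n) th i; set c := cof th i.
have aD : `|a| <= D * h by exact: dcof.
have bD t : `|sigma (b + t) - sigma t| <= G * (D * h).
  by rewrite (le_trans (lip _ _))// addrK ler_wpM2l//; exact: dpreact.
have eD t : `|sigma (e + t) - sigma t| <= G * (D * h).
  by rewrite (le_trans (lip _ _))// addrK ler_wpM2l//; exact: dpreact.
have bD' t : `|derive1 sigma (b + t) - derive1 sigma t| <= G * (D * h).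
  by rewrite (le_trans (lip' _ _))// addrK ler_wpM2l//; exact: dpreact.
have eD' t : `|derive1 sigma (e + t) - derive1 sigma t| <= G * (D * h).
  by rewrite (le_trans (lip' _ _))// addrK ler_wpM2l//; exact: dpreact.
have cQ : `|c| <= Q by exact: cofQ.
have c2 : `|c ^+ 2| <= Q ^+ 2 by rewrite !expr2; apply: normM_le.
have ac : `|a + 2 * c| <= D + 2 * Q.
  apply: normD_le; last by apply: normM_le => //; rewrite normr_nat.
  by rewrite (le_trans aD)// ler_piMr.
rewrite /kern.
(* Telescoping: one factor changes at a time, and the change of the squared outer weight is
   [a * (a + 2 * c)]. *)
rewrite (_ : _ - _ = (sigma (b + u) - sigma u) * sigma (e + v) +
    sigma u * (sigma (e + v) - sigma v) +
  (a * (a + 2 * c) * derive1 sigma (b + u) * derive1 sigma (e + v) +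
   c ^+ 2 * (derive1 sigma (b + u) - derive1 sigma u) * derive1 sigma (e + v) +
   c ^+ 2 * derive1 sigma u * (derive1 sigma (e + v) - derive1 sigma v)) *
   (dotv (x m) (x n) + 1)); last by ring.
rewrite (_ : C6 * h = G * (D * h) * G + G * (G * (D * h)) +
  (D * h * (D + 2 * Q) * G * G + Q ^+ 2 * (G * (D * h)) * G +
   Q ^+ 2 * G * (G * (D * h))) * K2); last by rewrite /C6; ring.
repeat (first [apply: normD_le => //|apply: normM_le => //]).
Qed.

End LevenbergMarquardtStep.

(** * Uniform constants for one step *)

Section Iteration.
Variable R : realType.

(** Gathers the preceding estimates under one constant chosen before [N], [beta], the activation,
    the data and the current parameter. The new weight bound [C] serves as [Q] in the next step. *)
Lemma lm_step_bounds (d M : nat) (G Q gam alpha : R) :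
  (0 < M)%N -> 1 <= G -> 1 <= Q -> 0 < gam -> 0 < alpha ->
  exists2 C : R, 0 <= C & forall (N : nat) (beta : R) (sigma : R -> R)
    (x : 'I_M -> 'rV[R]_d) (y : 'I_M -> R) (th : 'rV[R]_(N * d.+2)),
  let h := N%:R `^ (- (1 - beta)) in
  let gN := gam / N%:R `^ (2 * beta - 1) in
  let L := loss beta sigma x y in
  let th' := lmstep alpha gN L th in
  let r t m := fnet beta sigma t (x m) - y m in
  let B t := empirical_kernel sigma x t in
  (0 < N)%N -> h <= 1 -> bounded_activation sigma G ->
  (forall m j, `|x m 0 j| <= G) -> (forall m, `|r th m| <= Q) ->
  (forall i, `|cof th i| <= Q) -> C * h <= gam ->
  [/\ sysmat gN L th \in unitmx,
      (exists P : 'I_M -> R, [/\ forall m, `|P m| <= M%:R * Q,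
         forall n, `|gam * (P n - r th n) + \sum_(m < M) B th n m * P m| <= C * h &
         forall m, `|r th' m - r th m - alpha * (P m - r th m)| <= C * h]),
      (forall i, `|cof th' i| <= C) &
      (forall m n, `|B th' m n - B th m n| <= C * h)].
Proof.
move=> M0 G1 Q1 gam0 alpha0.
pose K := d%:R * G + 1.
pose A1 := 2 * Q * (G * K * (2 + Q * K)).
pose Z := 2 * (M%:R * Q * (G + Q * G * K)) / gam.
pose K2 := d%:R * G ^+ 2 + 1.
pose A2 := Q * (G * G * (K * Z) + Z * G * (Q * G * K2) +
  Q * G * (Q * G * K2) * (K * Z)).
pose D := alpha * (K * Z).
pose A3 := D + Q.
pose A4 := Q * (G * D ^+ 2) + D * (G * D).
pose A5 := G * D * G + G * (G * D) + (D * (D + 2 * Q) * G * G +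
  Q ^+ 2 * (G * D) * G + Q ^+ 2 * G * (G * D)) * K2.
pose C := `|A1| + `|A2| + `|A3| + `|A4| + `|A5|.
have [A1C A2C A3C A4C A5C] : [/\ A1 <= C, A2 <= C, A3 <= C, A4 <= C & A5 <= C].
  have := ler_norm A1; have := ler_norm A2; have := ler_norm A3.
  have := ler_norm A4; have := ler_norm A5.
  have := normr_ge0 A1; have := normr_ge0 A2; have := normr_ge0 A3.
  have := normr_ge0 A4; have := normr_ge0 A5.
  by rewrite /C => *; split; lra.
exists C; first by rewrite !addr_ge0.
move=> N beta sigma x y th h gN L th' r B N0 h1 sG xG rQ cQ Ch.
have h0 : 0 <= h by rewrite powR_ge0.
have gamh : A1 * h <= gam by rewrite (le_trans _ Ch)// ler_wpM2r.
have Cle A e : A <= C -> `|e : R| <= A * h -> `|e| <= C * h.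
  by move=> AC /le_trans; apply; rewrite ler_wpM2r.
split.
- exact: sysmat_unit gamh.
- exists (predicted_resid sigma beta x y th gam); split.
  + move=> m; exact: predicted_resid_le gamh m.
  + by move=> n; apply: Cle A2C _; exact: predicted_resid_eq gamh n.
  + move=> m; apply: Cle A4C _; rewrite /predicted_resid addrK /r.
    rewrite (_ : _ - _ - (_ - _) = fnet beta sigma th' (x m) - fnet beta sigma th (x m));
      last by ring.
    exact: (fnet_step N0 M0 G1 Q1 gam0 sG xG rQ cQ gamh alpha0).
- move=> i; apply: le_trans A3C.
  exact: (cof_step_le N0 M0 G1 Q1 gam0 sG xG rQ cQ gamh alpha0).
- move=> m n; apply: Cle A5C _.
  exact: (kernel_step N0 M0 G1 Q1 gam0 sG xG rQ cQ gamh alpha0).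
Qed.

(** * The resolvent of a positive kernel and the limiting residual map *)

Section Resolvent.
Variables (M : nat) (B : 'M[R]_M) (gam : R).
Hypotheses (M0 : (0 < M)%N) (gam0 : 0 < gam).
Hypothesis Bpsd : forall v : 'I_M -> R,
  0 <= \sum_(m < M) \sum_(n < M) v m * B m n * v n.

Lemma resolvent_unit : gam%:M + B \in unitmx.
Proof.
rewrite unitmxE unitfE; apply/negP => /det0P[v v0 vB].
move: v0 => /eqP; apply; apply/rowP => j; rewrite mxE; apply/eqP.
have : gam * (\sum_(m < M) v 0 m ^+ 2) + \sum_(m < M) \sum_(n < M) v 0 m * B m n * v 0 n = 0.
  transitivity ((v *m (gam%:M + B) *m v^T) 0 0); last by rewrite vB mul0mx mxE.
  rewrite mulmxDr mulmxDl mul_mx_scalar -scalemxAl mxE; congr (_ + _).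
    by rewrite !mxE; congr (_ * _); apply: eq_bigr => i _; rewrite mxE expr2.
  rewrite exchange_big mxE; apply: eq_bigr => n _; rewrite !mxE mulr_suml.
  by apply: eq_bigr.
move=> E; have := Bpsd (v 0); have := sqr_le_sum (v 0) j.
have := sqr_ge0 (v 0 j) => v1 v2 v3.
have : gam * v 0 j ^+ 2 <= 0.
  by apply: (le_trans (ler_wpM2l (ltW gam0) v2)); lra.
by rewrite pmulr_rle0// => v4; rewrite -sqrf_eq0 eq_le v1 v4.
Qed.

(** Pairing [gam (w - a) = - B w] with [w] and using positivity of [B] shows that [gam (gam + B)^-1]
    does not expand the Euclidean norm. *)
Lemma resolvent_sumsq (w a : 'cV[R]_M) : (gam%:M + B) *m w = gam *: a ->
  \sum_(m < M) w m 0 ^+ 2 <= \sum_(m < M) a m 0 ^+ 2.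
Proof.
move=> E; apply: (@sumsq_le _ _ (w^~ 0) (a^~ 0)).
rewrite -(pmulr_rle0 _ gam0) mulr_sumr.
rewrite (_ : \sum_(m < M) _ = - \sum_(m < M) \sum_(n < M) w m 0 * B m n * w n 0).
  by rewrite oppr_le0 (Bpsd (w^~ 0)).
rewrite -sumrN; apply: eq_bigr => m _.
have /(congr1 (fun u : 'cV[R]_M => u m 0)) : gam *: w + B *m w = gam *: a.
  by rewrite -E mulmxDl mul_scalar_mx.
rewrite !mxE => Em.
rewrite (_ : \sum_(n < M) _ = w m 0 * \sum_(n < M) B m n * w n 0); last first.
  by rewrite mulr_sumr; apply: eq_bigr => n _; rewrite mulrA.
by rewrite mulrCA mulrBr -Em; ring.
Qed.

Lemma resolvent_le (w a : 'cV[R]_M) A : 0 <= A ->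
  (gam%:M + B) *m w = gam *: a -> (forall m, `|a m 0| <= A) ->
  forall m, `|w m 0| <= M%:R * A.
Proof.
move=> A0 E aA; apply: (@norm_le_of_sumsq _ _ (w^~ 0) (a^~ 0)) => //.
exact: resolvent_sumsq.
Qed.

Lemma calBstar0E : calBstar0 gam B = 1%:M - gam *: invmx (gam%:M + B).
Proof.
rewrite /calBstar0 -{1}(addKr (gam%:M) B) mulmxDl mulmxV ?resolvent_unit//.
by rewrite addrC mulNmx mul_scalar_mx.
Qed.

Definition contraction (alpha : R) (v : 'cV[R]_M) : 'cV[R]_M :=
  v - alpha *: (calBstar0 gam B *m v).

Lemma contractionB alpha v w :
  contraction alpha (v - w) = contraction alpha v - contraction alpha w.
Proof.
rewrite /contraction mulmxBr; move: (_ *m v) (_ *m w) => v' w'.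
by apply/matrixP => i j; rewrite !mxE; ring.
Qed.

(** The factor exceeds 1, but it is independent of the spectrum of [B], and only finitely many steps
    are taken. Errors are propagated with this factor; the sharp one is reserved for the labels. *)
Lemma contraction_le alpha (a : 'cV[R]_M) A : 0 < alpha -> 0 <= A ->
  (forall m, `|a m 0| <= A) ->
  forall m, `|contraction alpha a m 0| <= (1 + alpha * (1 + M%:R)) * A.
Proof.
move=> alpha0 A0 aA m; pose w := gam *: (invmx (gam%:M + B) *m a).
have wA : `|w m 0| <= M%:R * A.
  apply: resolvent_le aA m => //.
  by rewrite -scalemxAr mulmxA mulmxV ?resolvent_unit// mul1mx.
rewrite /contraction calBstar0E mulmxBl mul1mx -scalemxAl -/w.
clearbody w; rewrite !mxE mulrDl mul1r; apply: normD_le => //.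
rewrite normrN normrM (gtr0_norm alpha0) -mulrA ler_pM2l//.
by rewrite mulrDl mul1r; apply: normD_le; rewrite ?normrN.
Qed.

(** Solving for [P] gives [gam (gam + B)^-1 r + (gam + B)^-1 rho], so the deviation from the
    limiting map is exactly [alpha (gam + B)^-1 rho]. *)
Lemma contraction_perturb alpha (r P rho : 'cV[R]_M) A : 0 < alpha -> 0 <= A ->
  gam *: (P - r) + B *m P = rho -> (forall m, `|rho m 0| <= A) ->
  forall m, `|(r + alpha *: (P - r) - contraction alpha r) m 0| <=
    alpha * (M%:R * (A / gam)).
Proof.
move=> alpha0 A0 E rA m.
pose w := invmx (gam%:M + B) *m rho.
have wA : `|w m 0| <= M%:R * (A / gam).
  apply: (@resolvent_le w (gam^-1 *: rho)) => //.
  - by rewrite divr_ge0// ltW.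
  - rewrite scalerA divff ?gt_eqF// scale1r.
    by rewrite mulmxA mulmxV ?resolvent_unit// mul1mx.
  - move=> k; rewrite !mxE normrM mulrC ler_pM//.
    by rewrite gtr0_norm ?invr_gt0.
rewrite (_ : _ - _ = alpha *: w).
  by rewrite mxE normrM (gtr0_norm alpha0) ler_pM2l.
rewrite /contraction calBstar0E mulmxBl mul1mx -scalemxAl.
have -> : w = P - gam *: (invmx (gam%:M + B) *m r).
  apply: (can_inj (mulKmx resolvent_unit)).
  rewrite mulmxBr -scalemxAr !mulmxA !mulmxV ?resolvent_unit// !mul1mx.
  by rewrite -E mulmxDl mul_scalar_mx scalerBr addrAC.
move: (gam *: _) => X.
by apply/matrixP => i j; rewrite !mxE; ring.
Qed.

End Resolvent.
End Iteration.

(** Induction on [K], carrying together the size of the residual, the outer weights, the distance of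
    the kernel to its limit and the distance to the limiting trajectory. The parameter [e] dominates
    both [h] and the initial kernel error, so one error scale persists while the constant grows. *)
Lemma lm_iterates (R : realType) (d M : nat) (G gam alpha Q : R) (K : nat) :
  (0 < M)%N -> 1 <= G -> 1 <= Q -> 0 < gam -> 0 < alpha ->
  exists2 C : R, 1 <= C & forall (N : nat) (beta : R) (sigma : R -> R)
    (x : 'I_M -> 'rV[R]_d) (y : 'I_M -> R) (th0 : 'rV[R]_(N * d.+2))
    (Bs : 'M[R]_M) (e : R),
  let h := N%:R `^ (- (1 - beta)) in
  let gN := gam / N%:R `^ (2 * beta - 1) in
  let L := loss beta sigma x y in
  let theta k := iter k (lmstep alpha gN L) th0 in
  let r t : 'cV[R]_M := \col_m (fnet beta sigma t (x m) - y m) in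
  let B t := empirical_kernel sigma x t in
  (0 < N)%N -> h <= 1 -> h <= e -> bounded_activation sigma G ->
  (forall m j, `|x m 0 j| <= G) ->
  (forall v : 'I_M -> R, 0 <= \sum_(m < M) \sum_(n < M) v m * Bs m n * v n) ->
  (forall m, `|r th0 m 0| <= Q) -> (forall i, `|cof th0 i| <= Q) ->
  (forall m n, `|B th0 m n - Bs m n| <= Q * e) -> C * h <= gam ->
  (forall k, (k < K)%N -> sysmat gN L (theta k) \in unitmx) /\
  [/\ forall m, `|r (theta K) m 0| <= C, forall i, `|cof (theta K) i| <= C,
      forall m n, `|B (theta K) m n - Bs m n| <= C * e &
      forall m, `|(r (theta K) - iter K (contraction Bs gam alpha) (r th0)) m 0| <= C * e].
Proof.
move=> M0 G1 Q1 gam0 alpha0; elim: K => [|K [C C1 IH]].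
  exists Q => // N beta sigma x y th0 Bs e h gN L theta r B N0 h1 he sG xG psd rQ cQ BQ _.
  split=> //; split=> // m; rewrite subrr mxE normr0 mulr_ge0//.
    exact: le_trans Q1.
  exact: le_trans (powR_ge0 _ _) he.
have [C' C'0 step] := @lm_step_bounds R d M G C gam alpha M0 G1 C1 gam0 alpha0.
have C0 : 0 <= C by exact: le_trans C1.
(* [A1] bounds the increment of the residual, [A2] the earlier error after one application of the
   limiting map, and [A3] the new error caused by the kernel mismatch and by the [O(h)] defect in
   the equation for [P]. *)
pose A1 := alpha * (M%:R * C + C).
pose A2 := (1 + alpha * (1 + M%:R)) * C.
pose A3 := alpha * (M%:R * ((C' + M%:R * (C * (M%:R * C))) / gam)).
have A10 : 0 <= A1 by rewrite !(mulr_ge0, addr_ge0)// ltW.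
have A20 : 0 <= A2 by rewrite !(mulr_ge0, addr_ge0)// ltW.
have A30 : 0 <= A3 by rewrite !(mulr_ge0, addr_ge0, invr_ge0)// ltW.
exists (C + C' + A1 + A2 + A3); first by lra.
move=> N beta sigma x y th0 Bs e h gN L theta r B N0 h1 he sG xG psd rQ cQ BQ Ch.
have h0 : 0 <= h by exact: powR_ge0.
have e0 : 0 <= e by exact: le_trans he.
have Ch1 : C * h <= gam by rewrite (le_trans _ Ch)// ler_wpM2r//; lra.
have Ch2 : C' * h <= gam by rewrite (le_trans _ Ch)// ler_wpM2r//; lra.
have [unitK [rK cK BK TK]] := IH N beta sigma x y th0 Bs e N0 h1 he sG xG psd rQ cQ BQ Ch1.
have rK' m : `|fnet beta sigma (theta K) (x m) - y m| <= C by have := rK m; rewrite mxE.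
have [uK [P [PC PE PT]] c' B'] := step N beta sigma x y (theta K) N0 h1 sG xG rK' cK Ch2.
split=> [k|]; first by rewrite ltnS leq_eqVlt => /predU1P[->//|/unitK].
set th' := lmstep _ _ _ _ in PT c' B'.
have C'h : C' * h <= C' * e by rewrite ler_wpM2l.
have C'h1 : C' * h <= C' by rewrite ler_piMr.
have Pr m : `|P m - (fnet beta sigma (theta K) (x m) - y m)| <= M%:R * C + C.
  by apply: normD_le; rewrite ?normrN.
split.
- move=> m; rewrite mxE -/th'.
  rewrite -[X in `|X|](subrK (fnet beta sigma (theta K) (x m) - y m)).
  set rm := fnet beta sigma (theta K) (x m) - y m; rewrite -[X in X + _](subrK (alpha * (P m - rm))).
  apply: (@le_trans _ _ (C' * h + A1 + C)); last by lra.
  apply: normD_le; last exact: rK'.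
  apply: normD_le; first exact: PT.
  by rewrite normrM (gtr0_norm alpha0) ler_pM2l.
- by move=> i; apply: (le_trans (c' i)); lra.
- move=> m n; rewrite -/th' -(subrK (B (theta K) m n) (B th' m n)) -addrA.
  apply: (@le_trans _ _ ((C' + C) * e)); last by rewrite ler_wpM2r//; lra.
  rewrite mulrDl; apply: normD_le; last exact: BK.
  exact: le_trans (B' _ _) C'h.
- move=> m; rewrite -/th'.
  pose rK0 := r (theta K); pose v := iter K (contraction Bs gam alpha) (r th0).
  have {}TK k : `|(rK0 - v) k 0| <= C * e by exact: TK.
  pose Pc : 'cV[R]_M := \col_m P m.
  pose rho : 'cV[R]_M := gam *: (Pc - rK0) + Bs *m Pc.
  have rhoE k : `|rho k 0| <= (C' + M%:R * (C * (M%:R * C))) * e.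
    rewrite (_ : rho k 0 = gam * (P k - (fnet beta sigma (theta K) (x k) - y k)) +
       \sum_(j < M) B (theta K) k j * P j +
       \sum_(j < M) (Bs k j - B (theta K) k j) * P j); last first.
      rewrite -addrA -big_split /= !mxE; congr (_ + _).
      by apply: eq_bigr => j _; rewrite mxE; ring.
    rewrite mulrDl; apply: normD_le; first exact: le_trans (PE _) C'h.
    rewrite -mulrA; apply: norm_sum_le => j.
    rewrite mulrAC; apply: normM_le => //.
    by rewrite distrC; exact: BK.
  have rho0 : 0 <= (C' + M%:R * (C * (M%:R * C))) * e.
    exact: le_trans (normr_ge0 _) (rhoE m).
  have := contraction_perturb M0 gam0 psd alpha0 rho0 (erefl rho) rhoE m.
  rewrite (_ : alpha * _ = A3 * e); last by rewrite /A3; ring.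
  move=> E1; have Ce0 : 0 <= C * e by rewrite mulr_ge0.
  have := contraction_le M0 gam0 psd alpha0 Ce0 TK m.
  rewrite mulrA -/A2 contractionB => E2.
  (* Propagated error, then the defect of the linear prediction, then the Taylor remainder of the
     network. *)
  have E3 : (r th' - contraction Bs gam alpha v) m 0 =
    (contraction Bs gam alpha rK0 - contraction Bs gam alpha v) m 0
    + ((rK0 + alpha *: (Pc - rK0) - contraction Bs gam alpha rK0) m 0 +
      (fnet beta sigma th' (x m) - y m - (fnet beta sigma (theta K) (x m) - y m) -
       alpha * (P m - (fnet beta sigma (theta K) (x m) - y m)))).
    move: (contraction _ _ _ v) (contraction _ _ _ rK0) => T1 T2.
    by rewrite !mxE; ring.
  suff : `|(r th' - contraction Bs gam alpha v) m 0| <= (C + C' + A1 + A2 + A3) * e by [].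
  rewrite E3.
  apply: (@le_trans _ _ (A2 * e + (A3 * e + C' * e))); last first.
    by rewrite -!mulrDl ler_wpM2r//; lra.
  apply: normD_le => //; apply: normD_le => //.
  exact: le_trans (PT _) C'h.
Qed.

(** * Spectral bound for real symmetric matrices *)

Section SymmetricContraction.
Variable R : rcfType.
Local Notation C := (complex.complex R).
Local Notation toC := (complex.real_complex_def (Phant R)).
Local Open Scope sesquilinear_scope.

Let nC n (u : 'rV[C]_n) : C := (u *m u ^t*) 0 0.

Let nCE n (u : 'rV[C]_n) : nC u = \sum_(j < n) `|u 0 j| ^+ 2.
Proof.
by rewrite /nC mxE; apply: eq_bigr => j _; rewrite !mxE -normCK.
Qed.

Let nC_unitary n (u : 'rV[C]_n) (P : 'M[C]_n) : P \is unitarymx ->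
  nC (u *m P) = nC u.
Proof.
move=> /unitarymxP PP; rewrite /nC trmx_mul map_mxM mulmxA -(mulmxA u) PP.
by rewrite mulmx1.
Qed.

(* Diagonalising [S] over [R[i]] by a unitary matrix; its eigenvalues are real. *)
Lemma symmetric_sub_scale_le n (S : 'M[R]_n) (alpha rho : R) (v : 'rV[R]_n) :
  S^T = S -> (forall a, eigenvalue S a -> `|1 - alpha * a| <= rho) ->
  \sum_(j < n) ((v - alpha *: (v *m S)) 0 j) ^+ 2 <=
  rho ^+ 2 * \sum_(j < n) v 0 j ^+ 2.
Proof.
move=> Ssym Seig; pose A := map_mx toC S; pose u := map_mx toC v.
have Aherm : A \is hermsymmx.
  apply: realsym_hermsym.
    apply/is_hermitianmxP; rewrite expr0 scale1r map_mx_id // /A map_trmx.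
    by rewrite Ssym.
  by apply/mxOverP => i j; rewrite mxE complex.complex_real.
have /orthomx_spectralP := hermitian_normalmx Aherm.
have := spectral_unitarymx A; have := mxOverP (hermitian_spectral_diag_real Aherm).
set P := spectralmx A; set sp := spectral_diag A => spR PU AE.
have PI : P \in unitmx by exact: unitarymx_unit.
have spE j : `|1 - toC alpha * sp 0 j| <= toC rho.
  have [a spa] : exists a, sp 0 j = toC a.
    by exists (complex.Re (sp 0 j)); rewrite complex.RRe_real.
  have : eigenvalue S a.
    suff : eigenvalue A (sp 0 j) by rewrite spa /A eigenvalue_map.
    apply/eigenvalueP.
    (* The rows of the diagonalising matrix are eigenvectors, and they are nonzero because that
       matrix is invertible. *)
    exists (row j P).
      rewrite -row_mul -/A AE !mulmxA mulmxV// mul1mx row_mul row_diag_mx.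
      by rewrite -scalemxAl -rowE.
    rewrite -row_free_unit in PI.
    apply/negP => /eqP P0; have := row_free_unit P; rewrite PI => /esym PI'.
    have : row j P *m invmx P = delta_mx 0 j.
      by rewrite -row_mul mulmxV// row1.
    rewrite P0 mul0mx => /matrixP/(_ 0 j)/eqP; rewrite !mxE !eqxx/= eq_sym.
    by rewrite oner_eq0.
  move=> /Seig; rewrite spa -(rmorph1 toC) -rmorphM -rmorphB /=.
  by rewrite complex.normc_def /= expr0n addr0 sqrtr_sqr complex.lecR.
have nT (w : 'rV[R]_n) : nC (map_mx toC w) = toC (\sum_(j < n) w 0 j ^+ 2).
  rewrite nCE rmorph_sum; apply: eq_bigr => j _.
  by rewrite mxE complex.normc_def /= expr0n addr0 -!rmorphXn /= sqr_sqrtr ?sqr_ge0// sqrtr_sqr real_normK// num_real.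
(* In the coordinates of the eigenbasis the map multiplies entry [j] by [1 - alpha * sp 0 j], and
   unitarity preserves the norm on both sides. *)
pose w := u *m invmx P.
have E1 : toC (\sum_(j < n) v 0 j ^+ 2) = nC w.
  by rewrite -nT -[RHS](nC_unitary _ PU) /w mulmxKV.
have E2 : toC (\sum_(j < n) ((v - alpha *: (v *m S)) 0 j) ^+ 2) =
    nC (\row_j (w 0 j * (1 - toC alpha * sp 0 j))).
  rewrite -nT -[RHS](nC_unitary _ PU); congr (nC _).
  rewrite map_mxB map_mxZ map_mxM -/A -/u {1}AE.
  have -> : \row_j (w 0 j * (1 - toC alpha * sp 0 j)) =
     w - toC alpha *: (w *m diag_mx sp).
    move: (w) => w'; rewrite mul_mx_diag.
    by apply/rowP => j; rewrite !mxE; ring.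
  by rewrite mulmxBl -scalemxAl /w !mulmxA mulmxKV.
rewrite -complex.lecR rmorphM /= E1 E2.
rewrite !nCE.
rewrite mulr_sumr; apply: ler_sum => j _.
rewrite mxE normrM exprMn mulrC ler_wpM2r ?exprn_ge0//.
rewrite rmorphXn ler_pXn2r ?nnegrE ?normr_ge0 ?spE//.
exact: le_trans (normr_ge0 _) (spE j).
Qed.

End SymmetricContraction.

(** * Expectations of bounded functions and independence *)

Section BoundedExpectations.
Context {R : realType}.

Lemma integrable_bounded d (T : measurableType d) (P : probability T R)
    (f : T -> R) (A : R) : measurable_fun setT f -> (forall t, `|f t| <= A) ->
  P.-integrable setT (EFin \o f).
Proof.
move=> mf fA; apply: measurable_bounded_integrable => //.
  by apply: (@le_lt_trans _ _ 1%E); [exact: probability_le1|exact: ltry].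
exists A; split; first exact: num_real.
by move=> B AB t _ /=; rewrite (le_trans (fA t))// ltW.
Qed.

Lemma Rintegral_sumE d (T : measurableType d) (P : probability T R) n
    (f : 'I_n -> T -> R) : (forall i, P.-integrable setT (EFin \o f i)) ->
  (\int[P]_t \sum_(i < n) f i t = \sum_(i < n) \int[P]_t f i t)%R.
Proof.
move=> fi; rewrite /Rintegral.
under eq_integral do rewrite -sumEFin.
rewrite integral_sum//.
by rewrite -sum_fine// => i _; exact: integrable_fin_num (fi i).
Qed.

(** Factorization on rectangles identifies the joint law of [(U, V)] with the product of the
    marginal laws; Fubini then splits the integral. *)
Lemma Rintegral_indep d d1 d2 (T : measurableType d) (T1 : measurableType d1)
    (T2 : measurableType d2) (P : probability T R) (U : T -> T1) (V : T -> T2)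
    (f : T1 -> R) (g : T2 -> R) (A B : R) :
  measurable_fun setT U -> measurable_fun setT V ->
  (forall A B, measurable A -> measurable B ->
    P (U @^-1` A `&` V @^-1` B) = P (U @^-1` A) * P (V @^-1` B))%E ->
  measurable_fun setT f -> measurable_fun setT g ->
  (forall t, `|f t| <= A) -> (forall t, `|g t| <= B) ->
  \int[P]_t (f (U t) * g (V t)) = \int[P]_t f (U t) * \int[P]_t g (V t).
Proof.
move=> mU mV UV mf mg fA gB.
pose X : {mfun T >-> T1} := HB.pack U (isMeasurableFun.Build _ _ _ _ U mU).
pose Y : {mfun T >-> T2} := HB.pack V (isMeasurableFun.Build _ _ _ _ V mV).
pose m1 := distribution P X; pose m2 := distribution P Y.
have mW : measurable_fun setT (fun t => (U t, V t)) by exact: measurable_fun_pair.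
pose W : {mfun T >-> (T1 * T2)%type} :=
  HB.pack (fun t => (U t, V t)) (isMeasurableFun.Build _ _ _ _ _ mW).
have WE (C : set (T1 * T2)) : measurable C -> (m1 \x m2)%E C = distribution P W C.
  by move=> mC; apply: product_measure_unique => // C1 C2 mC1 mC2; exact: UV.
pose h (z : T1 * T2) := (f z.1 * g z.2)%:E.
have mh : @measurable_fun _ _ (T1 * T2)%type (\bar R) setT h.
  apply/measurable_EFinP; apply: measurable_funM.
    exact: measurableT_comp mf measurable_fst.
  exact: measurableT_comp mg measurable_snd.
have hAB z : `|f z.1 * g z.2| <= A * B by exact: normM_le.
have ih : (m1 \x m2)%E.-integrable setT h.
  apply: (@integrable_bounded _ _ (m1 \x m2)%E (fun z => f z.1 * g z.2) (A * B)) => //.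
  exact/measurable_EFinP.
have mfU : measurable_fun setT (fun t => f (U t)) by exact: measurableT_comp.
have mgV : measurable_fun setT (fun t => g (V t)) by exact: measurableT_comp.
have ifU : P.-integrable setT (EFin \o (fun t => f (U t))).
  by apply: (@integrable_bounded _ _ _ _ A).
have igV : P.-integrable setT (EFin \o (fun t => g (V t))).
  by apply: (@integrable_bounded _ _ _ _ B).
have iI : P.-integrable setT (h \o W).
  apply: (@integrable_bounded _ _ P (fun t => f (U t) * g (V t)) (A * B)).
    exact: measurable_funM.
  by move=> t; exact: normM_le.
rewrite /Rintegral.
have -> : (\int[P]_t (f (U t) * g (V t))%:E = \int[m1 \x m2]_z h z)%E.
  rewrite (_ : \int[P]_t _ = \int[P]_t (h \o W) t)%E//.
  rewrite -integral_distribution//.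
  by apply: eq_measure_integral => C mC _; exact/esym/WE.
rewrite -integral12_prod_meas1// /fubini_F.
have gE : (\int[m2]_y (g y)%:E = \int[P]_t (g (V t))%:E)%E.
  by rewrite integral_distribution//; exact/measurable_EFinP.
have fE : (\int[m1]_x (f x)%:E = \int[P]_t (f (U t))%:E)%E.
  by rewrite integral_distribution//; exact/measurable_EFinP.
have gfin : (\int[P]_t (g (V t))%:E)%E \is a fin_num by exact: integrable_fin_num igV.
have ffin : (\int[P]_t (f (U t))%:E)%E \is a fin_num by exact: integrable_fin_num ifU.
rewrite -[X in _ = fine X * _]fE -[X in _ = _ * fine X]gE.
transitivity (fine (\int[m1]_x (fine (\int[m2]_y (g y)%:E) * f x)%:E)%E).
  congr fine; apply: eq_integral => x _; rewrite /h/=.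
  rewrite EFinM fineK ?gE// muleC -gE -integralZl//.
    apply: (@integrable_bounded _ _ m2 g B) => //.
under eq_integral do rewrite EFinM.
rewrite integralZl//; last by apply: (@integrable_bounded _ _ m1 f A).
by rewrite fineM// ?fE// ?gE// mulrC.
Qed.

End BoundedExpectations.

(** * Second moments of sums of independent variables *)

Section Concentration.
Context {R : realType}.

Lemma Rintegral_law d d1 (T : measurableType d) (T1 : measurableType d1)
    (P : probability T R) (mu : probability T1 R) (X : T -> T1) (f : T1 -> R) (A : R) :
  measurable_fun setT X -> (forall B, measurable B -> P (X @^-1` B) = mu B) ->
  measurable_fun setT f -> (forall t, `|f t| <= A) ->
  \int[P]_t f (X t) = \int[mu]_t f t.
Proof.
move=> mX XB mf fA.
pose Y : {mfun T >-> T1} := HB.pack X (isMeasurableFun.Build _ _ _ _ X mX).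
have mfX : measurable_fun setT (fun t => f (X t)) by exact: measurableT_comp.
have ifX : P.-integrable setT (EFin \o (fun t => f (X t))).
  by apply: (@integrable_bounded _ _ _ _ _ A).
rewrite /Rintegral; congr fine.
have <- : (\int[distribution P Y]_t (f t)%:E = \int[P]_t (f (X t))%:E)%E.
  by rewrite integral_distribution//; exact/measurable_EFinP.
by apply: eq_measure_integral => B mB _; exact: XB.
Qed.

(** The product formula over all indices is used with the full space at every index other than [i]
    and [j]. *)
Lemma iid_pair d0 (Om : measurableType d0) (P : probability Om R) N d
    (mu0 : probability (param R d) R) (th0 : 'I_N -> Om -> param R d) i j
    (A B : set (param R d)) : iid_law P mu0 th0 -> i != j ->
  measurable A -> measurable B ->
  (P (th0 i @^-1` A `&` th0 j @^-1` B) = P (th0 i @^-1` A) * P (th0 j @^-1` B))%E.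
Proof.
move=> [mth [law prodl]] ij mA mB.
pose D k : set (param R d) := if k == i then A else if k == j then B else setT.
have mD k : measurable (D k) by rewrite /D; case: ifP => // _; case: ifP.
have mpre k C : measurable C -> measurable (th0 k @^-1` C).
  by move=> mC; rewrite -[_ @^-1` _]setTI; exact: mth.
have := prodl D mD.
have -> : [set w | forall k, D k (th0 k w)] = th0 i @^-1` A `&` th0 j @^-1` B.
  apply/seteqP; split => [w Dw|w [Aw Bw] k].
    by split; [have := Dw i|have := Dw j]; rewrite /D eqxx// eq_sym (negbTE ij).
  by rewrite /D; case: eqP => [->//|_]; case: eqP => [->//|].
rewrite (bigD1 i)//= (bigD1 j)//= 1?eq_sym//= big1 => [|k /andP[ki kj]]; last first.
  by rewrite /D (negbTE ki) (negbTE kj) preimage_setT probability_setT.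
rewrite mulr1 /D eqxx [j == i]eq_sym (negbTE ij) eqxx => E.
rewrite -[LHS]fineK ?fin_num_measure//; last by apply: measurableI; exact: mpre.
by rewrite E EFinM !fineK ?fin_num_measure//; exact: mpre.
Qed.

(** Expanding the square, pairwise independence and centering kill the off-diagonal terms, so the
    bound is linear in [N]. *)
Lemma second_moment d0 (Om : measurableType d0) (P : probability Om R) N d
    (mu0 : probability (param R d) R) (th0 : 'I_N -> Om -> param R d)
    (f : param R d -> R) (A : R) : iid_law P mu0 th0 ->
  measurable_fun setT f -> (forall t, `|f t| <= A) -> \int[mu0]_t f t = 0 ->
  \int[P]_w (\sum_(i < N) f (th0 i w)) ^+ 2 <= N%:R * A ^+ 2.
Proof.
move=> iid mf fA f0; have [mth [law prodl]] := iid.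
have mfX i : measurable_fun setT (fun w => f (th0 i w)) by exact: measurableT_comp.
have fX0 i : \int[P]_w f (th0 i w) = 0.
  by rewrite -f0; apply: (Rintegral_law (mth i) _ mf fA) => B mB; exact: law.
have mff i j : measurable_fun setT (fun w => f (th0 i w) * f (th0 j w)).
  exact: measurable_funM.
have iff i j : P.-integrable setT (EFin \o (fun w => f (th0 i w) * f (th0 j w))).
  by apply: (@integrable_bounded _ _ _ _ _ (A * A)) => // t; exact: normM_le.
have -> : \int[P]_w (\sum_(i < N) f (th0 i w)) ^+ 2 =
    \sum_(i < N) \sum_(j < N) \int[P]_w (f (th0 i w) * f (th0 j w)).
  transitivity (\int[P]_w \sum_(i < N) \sum_(j < N) (f (th0 i w) * f (th0 j w))).
    congr fine; apply: eq_integral => w _; congr EFin.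
    by rewrite expr2 mulr_suml; apply: eq_bigr => i _; rewrite mulr_sumr.
  rewrite Rintegral_sumE => [|i].
    by apply: eq_bigr => i _; rewrite Rintegral_sumE.
  apply: (@integrable_bounded _ _ _ _ _ (N%:R * (A * A))).
    by apply: measurable_sum => j; exact: mff.
  by move=> w; apply: norm_sum_le => j; exact: normM_le.
rewrite mulr_natl -[N in _ *+ N]card_ord -sumr_const; apply: ler_sum => i _.
rewrite (bigD1 i)//= big1 ?addr0 => [|j ji]; last first.
  rewrite (Rintegral_indep (mth i) (mth j) _ mf mf fA fA) ?fX0 ?mul0r//.
  by move=> B C mB mC; apply: iid_pair iid _ mB mC; rewrite eq_sym.
have -> : A ^+ 2 = \int[P]_w (A ^+ 2).
  rewrite Rintegral_cst// (_ : fine _ = 1) ?mulr1//.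
  by rewrite -[1]/(fine 1%E); congr fine; exact: probability_setT.
apply: le_Rintegral => //.
  by apply: (@integrable_bounded _ _ _ _ _ `|A ^+ 2|).
move=> w _; apply: le_trans (ler_norm _) _.
by rewrite expr2; exact: normM_le.
Qed.

(** Markov's inequality is applied to the sum of all [n] squares at once: a single exceptional set
    of mass [delta] serves the whole family, without a union bound over [k]. *)
Lemma concentration d0 (Om : measurableType d0) (P : probability Om R) N d
    (mu0 : probability (param R d) R) (th0 : 'I_N -> Om -> param R d) n
    (f : 'I_n -> param R d -> R) (A delta : R) :
  iid_law P mu0 th0 -> (0 < N)%N -> (0 < n)%N -> 0 < A -> 0 < delta ->
  (forall k, measurable_fun setT (f k)) -> (forall k t, `|f k t| <= A) ->
  (forall k, \int[mu0]_t f k t = 0) ->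
  exists E : set Om, [/\ measurable E, (P (~` E) <= delta%:E)%E &
    forall w, E w -> \sum_(k < n) (\sum_(i < N) f k (th0 i w)) ^+ 2 <=
      n%:R * (N%:R * A ^+ 2) / delta].
Proof.
move=> iid N0 n0 A0 delta0 mf fA f0; have [mth _] := iid.
pose W w := \sum_(k < n) (\sum_(i < N) f k (th0 i w)) ^+ 2.
have msum k : measurable_fun setT (fun w => \sum_(i < N) f k (th0 i w)).
  by apply: measurable_sum => i; apply: measurableT_comp.
have msq k : measurable_fun setT (fun w => (\sum_(i < N) f k (th0 i w)) ^+ 2).
  exact: measurable_funX.
have mW : measurable_fun setT W by apply: measurable_sum => k; exact: msq.
have W0 w : 0 <= W w by apply: sumr_ge0 => k _; exact: sqr_ge0.
have bsq k w : `|(\sum_(i < N) f k (th0 i w)) ^+ 2| <= (N%:R * A) * (N%:R * A).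
  by rewrite expr2; apply: normM_le; apply: norm_sum_le => i; exact: fA.
have isq k : P.-integrable setT (EFin \o (fun w => (\sum_(i < N) f k (th0 i w)) ^+ 2)).
  exact: integrable_bounded (msq k) (bsq k).
pose t := n%:R * (N%:R * A ^+ 2) / delta.
have t0 : 0 < t by rewrite divr_gt0// !mulr_gt0 ?ltr0n ?exprn_gt0.
have iW : P.-integrable setT (EFin \o W).
  apply: (@integrable_bounded _ _ _ _ _ (n%:R * ((N%:R * A) * (N%:R * A)))) => // w.
  exact: norm_sum_le.
have EW : (\int[P]_w (W w)%:E <= (t * delta)%:E)%E.
  rewrite -[X in (X <= _)%E]fineK; last exact: integrable_fin_num iW.
  rewrite lee_fin [X in X <= _]Rintegral_sumE//.
  rewrite /t divfK ?gt_eqF//.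
  rewrite mulr_natl -[n in _ *+ n]card_ord -sumr_const; apply: ler_sum => k _.
  exact: second_moment iid (mf k) (fA k) (f0 k).
pose Y : {mfun Om >-> R} := HB.pack W (isMeasurableFun.Build _ _ _ _ W mW).
have mk := @markov _ _ _ P Y id t t0 (@measurable_id _ _ _) (fun r => id).
exists [set w | W w < t]; split.
- rewrite -[X in measurable X]setTI; exact: measurable_fun_ltr.
- have -> : ~` [set w | W w < t] = [set w | (t%:E <= `|(Y w)%:E|)%E].
    apply/seteqP; split => w /=; rewrite lee_fin ger0_norm ?W0//.
      by move/negP; rewrite -leNgt.
    by move=> tW; apply/negP; rewrite -leNgt.
  rewrite -(@lee_pmul2l _ t%:E)//; apply: le_trans (mk _) _ => //.
  rewrite unlock /= -EFinM; apply: le_trans EW.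
  rewrite le_eqVlt; apply/orP; left; apply/eqP.
  by apply: eq_integral => w _ /=; rewrite ger0_norm.
- by move=> w /ltW.
Qed.

End Concentration.

(** * The network and the kernel at initialization *)

Section Initialization.
Context {R : realType}.
Variable d : nat.

Definition tpre (xx : 'rV[R]_d) (t : (d.+1).-tuple R) : R :=
  dotv (\row_j tnth t (widen_ord (leqnSn d) j)) xx + tnth t ord_max.

(** The outer weight is bounded only almost surely, whereas [concentration] asks for bounds at every
    point. Truncating at [A] changes no integral against [mu0] and changes nothing outside a null
    event. *)
Definition clamp (A c : R) : R := Num.max (- A) (Num.min A c).

Lemma clamp_le A c : 0 <= A -> `|clamp A c| <= A.
Proof.
by move=> A0; rewrite ler_norml /clamp le_max lexx /= ge_max ge_min lexx /=; lra.
Qed.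

Lemma clamp_id A c : `|c| <= A -> clamp A c = c.
Proof.
by rewrite ler_norml /clamp => /andP[? ?]; rewrite min_r// max_r.
Qed.

Lemma measurable_clamp A : measurable_fun setT (clamp A).
Proof.
apply: measurable_maxr; first exact: measurable_cst.
by apply: measurable_minr; [exact: measurable_cst|exact: measurable_id].
Qed.

Lemma measurable_tpre xx : measurable_fun setT (tpre xx).
Proof.
apply: measurable_funD; last exact: measurable_tnth.
apply: measurable_sum => j; apply: measurable_funM; last exact: measurable_cst.
rewrite (_ : (fun _ => _) = (fun t : (d.+1).-tuple R => tnth t (widen_ord (leqnSn d) j))).
  exact: measurable_tnth.
by apply/funext => t; rewrite mxE.
Qed.

Lemma derivable_measurable_fun (f : R -> R) : (forall t, derivable f t 1) ->
  measurable_fun setT f.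
Proof.
move=> df; apply: continuous_measurable_fun => t.
exact/differentiable_continuous/derivable1_diffP.
Qed.

Lemma cof_init N (p : 'I_N -> param R d) i : cof (init_param p) i = (p i).1.
Proof. by rewrite /cof mxvecK mxE eqxx. Qed.

Lemma preact_init N (p : 'I_N -> param R d) xx i :
  preact xx (init_param p) i = tpre xx (p i).2.
Proof.
rewrite /preact /tpre /dotv; congr (_ + _).
  apply: eq_bigr => j _; rewrite mxE /wofth mxvecK mxE /=; congr (tnth _ _ * _).
  by apply/val_inj => /=; rewrite add0n inordK// ltnS ltnW.
rewrite /etaofth mxvecK mxE /=; congr (tnth _ _).
by apply/val_inj => /=; rewrite inordK.
Qed.

Variables (mu0 : probability (param R d) R).

Lemma measurable_large_weight (a : R) : measurable [set p : param R d | a < `|p.1|].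
Proof.
have mf : measurable_fun setT (fun p : param R d => a < `|p.1|).
  apply: measurable_fun_ltr; first exact: measurable_cst.
  by apply: measurableT_comp; [exact: normr_measurable|exact: measurable_fst].
by rewrite -[X in measurable X]setTI; exact: mf.
Qed.

Lemma good_init_bound : good_init mu0 -> exists2 A : R, 1 <= A &
  mu0 [set p : param R d | A < `|p.1|] = 0%E.
Proof.
move=> [_ [[Cc Cc0] _]]; exists (1 + `|Cc|); first by rewrite lerDl.
apply/eqP; rewrite eq_le measure_ge0 andbT -Cc0.
apply: le_measure; rewrite ?inE; try exact: measurable_large_weight.
by move=> p /= h; apply: le_lt_trans h; rewrite (le_trans (ler_norm Cc))// lerDr.
Qed.

Variable A : R.
Hypothesis A1 : 1 <= A.
Hypothesis good : good_init mu0.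
Hypothesis cA : mu0 [set p : param R d | A < `|p.1|] = 0%E.

Let A0 : 0 <= A. Proof. exact: le_trans A1. Qed.

Let ae_clamp (F : R -> (d.+1).-tuple R -> R) :
  measurable_fun setT (fun p : param R d => F p.1 p.2) ->
  measurable_fun setT (fun p : param R d => F (clamp A p.1) p.2) ->
  (\int[mu0]_p (F p.1 p.2)%:E = \int[mu0]_p (F (clamp A p.1) p.2)%:E)%E.
Proof.
move=> mF mF'; apply: ae_eq_integral => //.
- exact/measurable_EFinP.
- exact/measurable_EFinP.
- exists [set p : param R d | A < `|p.1|]; split => //.
    exact: measurable_large_weight.
  move=> p /= /not_implyP[_ pF]; rewrite ltNge; apply/negP => pA.
  by apply: pF; rewrite clamp_id.
Qed.

Variables (sigma : R -> R) (G Gs : R) (M : nat) (x : 'I_M -> 'rV[R]_d).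
Hypotheses (M0 : (0 < M)%N) (G1 : 1 <= G) (Gs1 : 1 <= Gs).
Hypothesis sigmaG : bounded_activation sigma G.
Hypothesis sigmaGs : forall t, `|sigma t| <= Gs.
Hypothesis xG : forall m j, `|x m 0 j| <= G.

Let msigma : measurable_fun setT sigma.
Proof. by case: sigmaG => -[/derivable_measurable_fun]. Qed.
Let mdsigma : measurable_fun setT (derive1 sigma).
Proof. by case: sigmaG => -[_ /derivable_measurable_fun]. Qed.

Let mfst : measurable_fun setT (fun p : param R d => p.1).
Proof. exact: measurable_fst. Qed.
Let mclamp : measurable_fun setT (fun p : param R d => clamp A p.1).
Proof. by apply: measurableT_comp; [exact: measurable_clamp|exact: measurable_fst]. Qed.
Let mpre (f : R -> R) m : measurable_fun setT f ->
  measurable_fun setT (fun p : param R d => f (tpre (x m) p.2)).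
Proof.
move=> mf; apply: measurableT_comp => //.
by apply: measurableT_comp; [exact: measurable_tpre|exact: measurable_snd].
Qed.

Let mkern (c : param R d -> R) m n : measurable_fun setT c ->
  measurable_fun setT (fun p : param R d =>
    kern sigma (x m) (x n) (c p) (tpre (x m) p.2) (tpre (x n) p.2)).
Proof.
move=> mc; rewrite /kern; apply: measurable_funD.
  by apply: measurable_funM; exact: mpre.
apply: measurable_funM; last exact: measurable_cst.
apply: measurable_funM; last exact: mpre.
apply: measurable_funM; last exact: mpre.
exact: measurable_funX.
Qed.

Definition clamped_kernel m n (p : param R d) : R :=
  kern sigma (x m) (x n) (clamp A p.1) (tpre (x m) p.2) (tpre (x n) p.2).
Notation k := clamped_kernel.

Definition kernel_bound : R := G * G + A * A * G * G * (d%:R * (G * G) + 1).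
Let Gk := kernel_bound.

Let kG m n p : `|k m n p| <= Gk.
Proof.
have [[_ _ sG s'G _] _] := sigmaG.
apply: normD_le; first exact: normM_le.
apply: normM_le; last first.
  apply: normD_le; last by rewrite normr1.
  by apply: norm_sum_le => j; apply: normM_le.
rewrite expr2; do 2 (apply: normM_le => //).
by apply: normM_le; exact: clamp_le.
Qed.

Let mk m n : measurable_fun setT (k m n).
Proof. exact: mkern. Qed.

Let ik m n : mu0.-integrable setT (EFin \o k m n).
Proof. exact: integrable_bounded (mk m n) (kG m n). Qed.

Lemma Bstar0_clamped m n : Bstar0 mu0 sigma x m n =
  M%:R^-1 * \int[mu0]_p k m n p.
Proof.
rewrite mxE; congr (_ * fine _).
exact: (@ae_clamp (fun c t => kern sigma (x m) (x n) c (tpre (x m) t) (tpre (x n) t))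
  (mkern _ _ mfst) (mkern _ _ mclamp)).
Qed.

Lemma kernC (m n : 'I_M) c u v : kern sigma (x m) (x n) c u v = kern sigma (x n) (x m) c v u.
Proof.
rewrite /kern (_ : dotv (x m) (x n) = dotv (x n) (x m)); first by ring.
by apply: eq_bigr => j _; rewrite mulrC.
Qed.

Lemma Bstar0_sym : (Bstar0 mu0 sigma x)^T = Bstar0 mu0 sigma x.
Proof.
apply/matrixP => m n; rewrite mxE !Bstar0_clamped; congr (_ * fine _).
by apply: eq_integral => p _; rewrite /k kernC.
Qed.

(* The kernel is the Gram matrix of the gradient features of one neuron. *)
Lemma kern_psd (c : R) (u v : 'I_M -> R) :
  0 <= \sum_(m < M) \sum_(n < M) v m * kern sigma (x m) (x n) c (u m) (u n) * v n.
Proof.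
have gram (a : 'I_M -> R) :
    \sum_(m < M) \sum_(n < M) a m * a n = (\sum_(m < M) a m) ^+ 2.
  by rewrite expr2 mulr_suml; apply: eq_bigr => m _; rewrite mulr_sumr.
pose s' := derive1 sigma.
rewrite (_ : \sum_(m < M) _ = \sum_(m < M) \sum_(n < M)
    (v m * sigma (u m)) * (v n * sigma (u n)) +
  c ^+ 2 * (\sum_(j < d) \sum_(m < M) \sum_(n < M)
    (v m * s' (u m) * x m 0 j) * (v n * s' (u n) * x n 0 j) +
   \sum_(m < M) \sum_(n < M) (v m * s' (u m)) * (v n * s' (u n)))).
  rewrite !gram addr_ge0 ?sqr_ge0// mulr_ge0 ?sqr_ge0// addr_ge0 ?sqr_ge0//.
  by apply: sumr_ge0 => j _; rewrite gram sqr_ge0.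
have -> : \sum_(j < d) \sum_(m < M) \sum_(n < M)
    (v m * s' (u m) * x m 0 j) * (v n * s' (u n) * x n 0 j) =
    \sum_(m < M) \sum_(n < M) v m * s' (u m) * (v n * s' (u n)) * dotv (x m) (x n).
  rewrite exchange_big; apply: eq_bigr => m _; rewrite exchange_big.
  apply: eq_bigr => n _; rewrite /dotv mulr_sumr; apply: eq_bigr => j _ /=.
  by ring.
rewrite -big_split mulr_sumr -big_split; apply: eq_bigr => m _ /=.
rewrite -big_split mulr_sumr -big_split; apply: eq_bigr => n _ /=.
by rewrite /kern -/s'; ring.
Qed.

Lemma Bstar0_psd (v : 'I_M -> R) :
  0 <= \sum_(m < M) \sum_(n < M) v m * Bstar0 mu0 sigma x m n * v n.
Proof.
have iv m n : mu0.-integrable setT (EFin \o (fun p => v m * k m n p * v n)).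
  apply: (@integrable_bounded _ _ _ _ _ (`|v m| * Gk * `|v n|)).
    apply: measurable_funM; last exact: measurable_cst.
    by apply: measurable_funM; [exact: measurable_cst|exact: mk].
  by move=> p; do 2 (apply: normM_le => //).
have mv m n : measurable_fun setT (fun p => v m * k m n p * v n).
  by have /measurable_int/measurable_EFinP := iv m n.
rewrite (_ : \sum_(m < M) _ = M%:R^-1 * \int[mu0]_p
   \sum_(m < M) \sum_(n < M) v m * k m n p * v n).
  rewrite mulr_ge0 ?invr_ge0//; apply: Rintegral_ge0 => p _; exact: kern_psd.
rewrite Rintegral_sumE => [|m]; last first.
  apply: (@integrable_bounded _ _ _ _ _ (M%:R * (\sum_(n < M) `|v m| * Gk * `|v n|))).
    by apply: measurable_sum => n; exact: mv.
  move=> p; rewrite (le_trans (ler_norm_sum _ _ _))//.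
  apply: (@le_trans _ _ (\sum_(n < M) `|v m| * Gk * `|v n|)).
    by apply: ler_sum => n _; do 2 (apply: normM_le => //).
  rewrite ler_peMl ?ler1n// sumr_ge0// => n _.
  by rewrite !mulr_ge0// (le_trans _ (kG m n p)).
rewrite mulr_sumr; apply: eq_bigr => m _; rewrite Rintegral_sumE// mulr_sumr.
apply: eq_bigr => n _; rewrite Bstar0_clamped.
rewrite (@RintegralZr _ _ _ _ _ (fun p => v m * k m n p))//; last first.
  apply: (@integrable_bounded _ _ _ _ _ (`|v m| * Gk)).
    by apply: measurable_funM; [exact: measurable_cst|exact: mk].
  by move=> p; apply: normM_le.
by rewrite RintegralZl//; ring.
Qed.

Definition clamped_output m (p : param R d) : R := clamp A p.1 * sigma (tpre (x m) p.2).

(** The two projections are independent under [mu0], so the mean of [c] factors out, and truncation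
    does not alter it. *)
Lemma clamped_output_mean m : \int[mu0]_p clamped_output m p = 0.
Proof.
have [ind [_ [mean0 _]]] := good.
rewrite (@Rintegral_indep _ _ _ _ _ _ _ mu0 fst snd (clamp A)
  (fun t => sigma (tpre (x m) t)) A Gs)//.
- rewrite (_ : \int[mu0]_t _ = 0) ?mul0r//.
  have := ae_clamp (F := fun c _ => c) mfst mclamp.
  by rewrite mean0 /Rintegral => <-.
- move=> B C mB mC.
  have -> : fst @^-1` B `&` snd @^-1` C = B `*` C by [].
  rewrite ind//; congr (mu0 _ * mu0 _)%E.
  + by apply/seteqP; split => [p []|p Bp].
  + by apply/seteqP; split => [p []|p Bp].
- exact: measurable_clamp.
- by apply: measurableT_comp => //; exact: measurable_tpre.
- by move=> c; exact: clamp_le.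
Qed.

(** Each of the two fluctuations, outputs and kernel entries, costs one [delta]; the bound on the
    weights costs nothing. *)
Lemma init_event N d0 (Om : measurableType d0) (P : probability Om R)
    (th0 : 'I_N -> Om -> param R d) (delta : R) :
  (0 < N)%N -> 0 < delta -> iid_law P mu0 th0 ->
  exists E : set Om, [/\ measurable E, ((1 - 2 * delta)%:E <= P E)%E &
    forall w, E w -> let th := init_param (th0^~ w) in
     [/\ forall i, `|cof th i| <= A,
         \sum_(m < M) (\sum_(i < N) cof th i * sigma (preact (x m) th i)) ^+ 2 <=
           M%:R * (N%:R * (A * Gs) ^+ 2) / delta &
         forall m n, (N%:R * (M%:R * (empirical_kernel sigma x th m n -
             Bstar0 mu0 sigma x m n))) ^+ 2 <=
           (M * M)%:R * (N%:R * (2 * Gk) ^+ 2) / delta]].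
Proof.
move=> N0 delta0 iid; have [mth [law _]] := iid.
have Gs0 : 0 < Gs by exact: lt_le_trans Gs1.
have A0' : 0 < A by exact: lt_le_trans A1.
have G0 : 0 < G by exact: lt_le_trans G1.
have Gk0 : 0 < Gk.
  apply: ltr_wpDr; last exact: mulr_gt0.
  by rewrite !(mulr_ge0, addr_ge0)// ltW.
have mout m : measurable_fun setT (clamped_output m).
  by apply: measurable_funM => //; exact: mpre.
have outA m p : `|clamped_output m p| <= A * Gs.
  by apply: normM_le => //; exact: clamp_le.
have [E1 [mE1 PE1 hE1]] := concentration iid N0 M0 (mulr_gt0 A0' Gs0) delta0
  mout outA clamped_output_mean.
(* All pairs of data points are flattened into one index set, so that the whole kernel matrix is a
   single centered family. *)
pose I := {: 'I_M * 'I_M}.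
pose kc (q : 'I_#|I|) (p : param R d) :=
  k (enum_val q).1 (enum_val q).2 p - \int[mu0]_p k (enum_val q).1 (enum_val q).2 p.
have I0 : (0 < #|I|)%N by rewrite card_prod card_ord muln_gt0 M0.
have intG m n : `|\int[mu0]_p k m n p| <= Gk.
  apply: (le_trans (le_normr_Rintegral _ (ik m n))) => //.
  have -> : Gk = \int[mu0]_p Gk.
    rewrite Rintegral_cst// (_ : fine _ = 1) ?mulr1//.
    by rewrite -[1]/(fine 1%E); congr fine; exact: probability_setT.
  apply: le_Rintegral => //.
    apply: (@integrable_bounded _ _ _ _ _ Gk) => [|t]; last by rewrite normr_id.
    by apply: measurableT_comp => //; exact: mk.
  by apply: (@integrable_bounded _ _ _ _ _ `|Gk|).
have mkc q : measurable_fun setT (kc q).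
  by apply: measurable_funB; [exact: mk|exact: measurable_cst].
have kcG q p : `|kc q p| <= 2 * Gk.
  by rewrite mulr_natl mulr2n; apply: normD_le; rewrite ?normrN.
have kc0 q : \int[mu0]_p kc q p = 0.
  rewrite RintegralB//; last first.
    by apply: (@integrable_bounded _ _ _ _ _ Gk) => //.
  rewrite Rintegral_cst// (_ : fine _ = 1) ?mulr1 ?subrr//.
  by rewrite -[1]/(fine 1%E); congr fine; exact: probability_setT.
have [E2 [mE2 PE2 hE2]] := concentration iid N0 I0 (mulr_gt0 (ltr0Sn _ 1) Gk0) delta0
  mkc kcG kc0.
pose B := [set p : param R d | A < `|p.1|].
have mB : measurable B by exact: measurable_large_weight.
(* Some neuron starts with an outer weight beyond [A]: a finite union of null sets, outside which
   truncation is the identity. *)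
pose D := \bigcup_(i : 'I_N) (th0 i @^-1` B).
have mpreB i : measurable (th0 i @^-1` B).
  by rewrite -[_ @^-1` _]setTI; exact: mth.
have mD : measurable D.
  by apply: fin_bigcup_measurable => //; exact: finite_finset.
have PD : P D = 0%E.
  apply/eqP; rewrite eq_le measure_ge0 andbT.
  have : (P D <= \sum_(i \in [set: 'I_N]) P (th0 i @^-1` B))%E.
    by apply: content_sub_fsum => //; exact: finite_finset.
  by rewrite fsbig1// => i _; exact: etrans (law i B mB) _.
exists (E1 `&` E2 `&` ~` D); split.
- by apply: measurableI; [exact: measurableI|exact: measurableC].
- have -> : E1 `&` E2 `&` ~` D = ~` (~` E1 `|` ~` E2 `|` D).
    by rewrite !setCU !setCK.
  have mC1 := measurableC mE1; have mC2 := measurableC mE2.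
  rewrite probability_setC; last by apply: measurableU => //; exact: measurableU.
  rewrite EFinB leeB//.
  apply: (le_trans (measureU2 _ (measurableU _ _ mC1 mC2) mD)).
  apply: (@le_trans _ _ ((delta%:E + delta%:E) + 0)%E).
    apply: leeD; last by have PD0 : (P D <= 0)%E by rewrite PD.
    exact: le_trans (measureU2 _ mC1 mC2) (leeD PE1 PE2).
  by rewrite adde0 mulr_natl mulr2n EFinD.
- move=> w [[w1 w2] wD] th.
  have cw i : `|(th0 i w).1| <= A.
    by rewrite leNgt; apply/negP => h; apply: wD; exists i.
  split.
  + by move=> i; rewrite cof_init.
  + apply: le_trans (hE1 w w1); rewrite le_eqVlt; apply/orP; left; apply/eqP.
    apply: eq_bigr => m _; congr (_ ^+ 2); apply: eq_bigr => i _.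
    by rewrite cof_init preact_init /clamped_output clamp_id.
  + move=> m n; have cI : (M * M)%:R = #|I|%:R :> R by rewrite card_prod card_ord.
    rewrite cI; apply: le_trans (hE2 w w2).
    apply: le_trans (sqr_le_sum (fun q => \sum_(i < N) kc q (th0 i w)) (enum_rank (m, n))).
    rewrite le_eqVlt; apply/orP; left; apply/eqP; congr (_ ^+ 2).
    rewrite /kc enum_rankK /= sumrB sumr_const card_ord -mulr_natl.
    rewrite /empirical_kernel Bstar0_clamped.
    rewrite (_ : \sum_(i < N) k m n (th0 i w) = \sum_(i < N) kern sigma (x m) (x n)
      (cof th i) (preact (x m) th i) (preact (x n) th i)).
      by field; rewrite !pnatr_eq0 -!lt0n M0 N0.
    by apply: eq_bigr => i _; rewrite cof_init !preact_init /k /clamped_kernel clamp_id.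
Qed.

End Initialization.

(** * Euclidean norms, rates in the width and the contraction factor *)

Section FinalBounds.
Variable R : realType.

(** Cauchy-Schwarz comes from expanding the squares of [|b| a_j - |a| b_j]; vanishing norms are
    treated apart since [|a| |b|] is divided out. *)
Lemma norm2fD n (a b : 'I_n -> R) :
  norm2f (fun j => a j + b j) <= norm2f a + norm2f b.
Proof.
have n0 (c : 'I_n -> R) : 0 <= norm2f c by exact: sqrtr_ge0.
have nE (c : 'I_n -> R) : norm2f c ^+ 2 = \sum_(j < n) c j ^+ 2.
  by rewrite sqr_sqrtr// sumr_ge0// => j _; exact: sqr_ge0.
have CS : \sum_(j < n) a j * b j <= norm2f a * norm2f b.
  apply/ler_addgt0Pr => e e0.
  have [na|na] := leP (norm2f a) 0.
    have a0 : norm2f a = 0 by apply/eqP; rewrite eq_le na n0.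
    rewrite a0 mul0r add0r big1 ?ltW// => j _.
    have : a j ^+ 2 <= 0 by rewrite (le_trans (sqr_le_sum a j))// -nE a0 expr0n.
    by rewrite -[_ <= _]andTb -(sqr_ge0 (a j)) => /le_anti/esym/eqP; rewrite sqrf_eq0 => /eqP->; rewrite mul0r.
  have [nb|nb] := leP (norm2f b) 0.
    have b0 : norm2f b = 0 by apply/eqP; rewrite eq_le nb n0.
    rewrite b0 mulr0 add0r big1 ?ltW// => j _.
    have : b j ^+ 2 <= 0 by rewrite (le_trans (sqr_le_sum b j))// -nE b0 expr0n.
    by rewrite -[_ <= _]andTb -(sqr_ge0 (b j)) => /le_anti/esym/eqP; rewrite sqrf_eq0 => /eqP->; rewrite mulr0.
  have : 0 <= \sum_(j < n) (norm2f b * a j - norm2f a * b j) ^+ 2.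
    by rewrite sumr_ge0// => j _; exact: sqr_ge0.
  rewrite (_ : \sum_(j < n) _ = 2 * (norm2f a * norm2f b) *
     (norm2f a * norm2f b - \sum_(j < n) a j * b j)).
    rewrite pmulr_rge0 ?mulr_gt0// subr_ge0 => /le_trans; apply.
    by rewrite lerDl ltW.
  transitivity (norm2f b ^+ 2 * norm2f a ^+ 2 - 2 * (norm2f a * norm2f b) *
     (\sum_(j < n) a j * b j) + norm2f a ^+ 2 * norm2f b ^+ 2); last by ring.
  rewrite [X in _ * X - _]nE [X in _ + _ * X]nE !mulr_sumr -sumrN -!big_split /=.
  by apply: eq_bigr => j _; ring.
rewrite -ler_sqr ?nnegrE ?addr_ge0// nE.
rewrite (_ : \sum_(j < n) _ = norm2f a ^+ 2 + 2 * (\sum_(j < n) a j * b j) + norm2f b ^+ 2).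
  rewrite (_ : (_ + _) ^+ 2 = norm2f a ^+ 2 + 2 * (norm2f a * norm2f b) + norm2f b ^+ 2).
    by rewrite lerD2r lerD2l ler_pM2l.
  by ring.
by rewrite !nE mulr_sumr -!big_split; apply: eq_bigr => j _ /=; ring.
Qed.

Lemma norm2f_le n (a : 'I_n -> R) A : 0 <= A -> (forall j, `|a j| <= A) ->
  norm2f a <= Num.sqrt n%:R * A.
Proof.
move=> A0 aA; rewrite -[A in _ * A]ger0_norm// -sqrtr_sqr -sqrtrM ?ler0n//.
apply: ler_wsqrtr; rewrite mulr_natl -[n in _ *+ n]card_ord -sumr_const.
apply: ler_sum => j _.
by rewrite -real_normK ?num_real// ler_sqr ?nnegrE.
Qed.

(** [s ^ 2 * N] is the order of the variance of an initial output and [1 / N] that of a kernel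
    entry. Both are at most [u ^ 2], the second because [2 * beta - 1 < 1]. *)
Lemma rates (N : nat) (beta delta : R) : (0 < N)%N -> 1 / 2 < beta < 1 ->
  0 < delta <= 1 / 2 ->
  let u := N%:R `^ (- (beta - 1 / 2)) in let h := N%:R `^ (- (1 - beta)) in
  let s := N%:R `^ (- beta) in
  [/\ 0 < u, 0 < h <= 1, N%:R `^ (2 * beta - 1) = (u ^+ 2)^-1,
      s ^+ 2 * N%:R = u ^+ 2 & N%:R^-1 <= u ^+ 2 :> R].
Proof.
move=> N0 /andP[b1 b2] /andP[d0 d1] u h s.
have NR : 0 < N%:R :> R by rewrite ltr0n.
have N1 : 1 <= N%:R :> R by rewrite ler1n.
have Nn : N%:R != 0 :> R by rewrite gt_eqF.
have u2 : u ^+ 2 = N%:R `^ (- (2 * beta - 1)).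
  rewrite expr2 /u -powRD ?Nn ?implybT//; congr (_ `^ _); lra.
split.
- exact: powR_gt0.
- rewrite powR_gt0//= -[X in _ <= X](powRr0 (N%:R : R)) ler_powR//; lra.
- by rewrite u2 powRN invrK.
- rewrite u2 expr2 -[X in _ * X](powRr1 (ltW NR)) -!powRD ?Nn ?implybT//.
  by congr (_ `^ _); lra.
- rewrite u2 -powR_inv1 ?ler0n// ler_powR//; lra.
Qed.

(** * Contraction of the limiting recursion *)

Section SpectralStep.
Variables (M : nat) (B : 'M[R]_M) (gam alpha lmin lmax : R).
Hypotheses (M0 : (0 < M)%N) (gam0 : 0 < gam) (alpha0 : 0 < alpha).
Hypothesis Bpsd : forall v : 'I_M -> R,
  0 <= \sum_(m < M) \sum_(n < M) v m * B m n * v n.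
Hypothesis Bsym : B^T = B.
Hypothesis lminP : is_min_eig (calBstar0 gam B) lmin.
Hypothesis lmaxP : is_max_eig (calBstar0 gam B) lmax.
Hypothesis alpha_lt : alpha < 2 / (lmax + lmin).

Lemma calBstar0_sym : (calBstar0 gam B)^T = calBstar0 gam B.
Proof.
rewrite calBstar0E// linearB linearZ /= trmx1 trmx_inv linearD /= tr_scalar_mx.
by rewrite Bsym.
Qed.

(** The step size condition says that [alpha * lmax - 1 < 1 - alpha * lmin], so the lower end of the
    spectrum controls both signs of [1 - alpha * a]. *)
Lemma contraction_factor_eig a : eigenvalue (calBstar0 gam B) a ->
  `|1 - alpha * a| <= 1 - alpha * lmin.
Proof.
move=> ea; have [_ /(_ a ea) amin] := lminP; have [_ /(_ a ea) amax] := lmaxP.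
(* With [2 / 0 = 0], a positive [alpha] below [2 / (lmax + lmin)] forces [lmax + lmin > 0]. *)
have s0 : 0 < lmax + lmin.
  by rewrite -invr_gt0 -(pmulr_rgt0 _ (ltr0Sn R 1)); exact: lt_trans alpha_lt.
move: alpha_lt; rewrite ltr_pdivlMr// => al.
have m1 : alpha * lmin <= alpha * a by rewrite ler_pM2l.
have m2 : alpha * a <= alpha * lmax by rewrite ler_pM2l.
by rewrite ler_norml; apply/andP; split; lra.
Qed.

Lemma contraction_factor_ge0 : 0 <= 1 - alpha * lmin.
Proof.
by have [e _] := lminP; apply: le_trans (contraction_factor_eig e); exact: normr_ge0.
Qed.

Lemma contraction_norm (v : 'cV[R]_M) :
  norm2f (fun m => contraction B gam alpha v m 0) <=
  (1 - alpha * lmin) * norm2f (fun m => v m 0).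
Proof.
have rho0 := contraction_factor_ge0.
(* The spectral bound acts on rows; symmetry turns the transpose of [S v] into [v^T S]. *)
have := symmetric_sub_scale_le v^T calBstar0_sym contraction_factor_eig.
set X := \sum_(j < M) _ => H.
rewrite -[X in X * _]ger0_norm// -sqrtr_sqr -sqrtrM ?sqr_ge0//.
apply: ler_wsqrtr; apply: le_trans (le_trans _ H) _; last first.
  by rewrite ler_wpM2l ?sqr_ge0//; apply: ler_sum => j _; rewrite mxE.
apply: ler_sum => j _; rewrite /contraction -{2}calBstar0_sym -trmx_mul.
by move: (_ *m v) => w; rewrite !mxE.
Qed.

Lemma iter_contraction_norm k (v : 'cV[R]_M) :
  norm2f (fun m => iter k (contraction B gam alpha) v m 0) <=
  (1 - alpha * lmin) ^+ k * norm2f (fun m => v m 0).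
Proof.
elim: k => [|k IH]; first by rewrite expr0 mul1r.
rewrite exprS -mulrA; apply: le_trans (contraction_norm _) _.
by rewrite ler_wpM2l// contraction_factor_ge0.
Qed.

Lemma iter_contraction_le k (v : 'cV[R]_M) A : 0 <= A ->
  (forall m, `|v m 0| <= A) -> forall m,
  `|iter k (contraction B gam alpha) v m 0| <= (1 + alpha * (1 + M%:R)) ^+ k * A.
Proof.
move=> A0 vA; elim: k => [|k IH] m; first by rewrite expr0 mul1r.
rewrite exprS -mulrA; apply: contraction_le => //.
by rewrite mulr_ge0// exprn_ge0// addr_ge0// mulr_ge0 ?addr_ge0// ltW.
Qed.

Lemma iter_contractionB k (v w : 'cV[R]_M) :
  iter k (contraction B gam alpha) (v - w) =
  iter k (contraction B gam alpha) v - iter k (contraction B gam alpha) w.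
Proof. by elim: k => //= k ->; rewrite contractionB. Qed.

End SpectralStep.

Lemma good_activation_bounded (sigma : R -> R) (Cs Cs' Cs'' Ls Ls' G : R) :
  good_activation sigma Cs Cs' Cs'' Ls Ls' ->
  [/\ Cs <= G, Cs' <= G, Cs'' <= G, Ls <= G & Ls' <= G] ->
  bounded_activation sigma G.
Proof.
move=> [d1 [d2 [_ [b0 [b1 [b2 [l0 l1]]]]]]] [g0 g1 g2 g3 g4].
split; [split=> // t|split=> a b].
- exact: le_trans g0.
- exact: le_trans g1.
- exact: le_trans g2.
- by rewrite (le_trans (l0 a b))// ler_wpM2r.
- by rewrite (le_trans (l1 a b))// ler_wpM2r.
Qed.

Lemma norm2_coord d (v : 'rV[R]_d) j : `|v 0 j| <= norm2 v.
Proof.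
rewrite -sqrtr_sqr; apply: ler_wsqrtr.
exact: (sqr_le_sum (fun j => v 0 j)).
Qed.

(** A second moment naturally yields the inverse square root of [delta]; it is weakened to
    [1 / delta], the form of the final bound. *)
Lemma sqr_le_quot (a X Y delta : R) : 0 <= X -> 0 <= Y -> 0 < delta <= 1 / 2 ->
  a ^+ 2 <= X ^+ 2 * Y ^+ 2 / delta -> `|a| <= X * (Y / delta).
Proof.
move=> X0 Y0 /andP[d0 d1] aXY; apply: le_sqr_norm.
  by rewrite !mulr_ge0// invr_ge0 ltW.
apply: (le_trans aXY); rewrite !exprMn mulrA ler_wpM2l//.
  by rewrite mulr_ge0 ?sqr_ge0.
rewrite expr2 ler_peMl ?invr_ge0 ?(ltW d0)// invf_ge1//; lra.
Qed.

End FinalBounds.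

(** * Choice of the constants and assembly *)

Unset Implicit Arguments.

Theorem mainTheorem5 (R : realType) (d : nat) (Cs Cs' Cs'' Ls Ls' : R)
    (mu0 : probability (param R d) R) :
  (1 <= d)%N -> good_init mu0 ->
  exists C1 : R, 0 < C1 /\
  forall (K : nat) (CR0 alpha gamma : R) (M : nat) (Cx Cy : R),
    0 < gamma -> (1 <= M)%N -> Cy < CR0 -> 0 < alpha ->
  exists Cgamma C : R, 0 < Cgamma /\ 0 < C /\
  forall (delta beta : R) (sigma : R -> R) (x : 'I_M -> 'rV[R]_d) (y : 'I_M -> R)
         (lmin lmax : R) (N : nat),
    0 < delta <= 1 / 2 -> 1 / 2 < beta < 1 ->
    good_activation sigma Cs Cs' Cs'' Ls Ls' ->
    good_data x y Cx Cy ->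
    is_min_eig (calBstar0 gamma (Bstar0 mu0 sigma x)) lmin ->
    is_max_eig (calBstar0 gamma (Bstar0 mu0 sigma x)) lmax ->
    alpha < 2 / (lmax + lmin) ->
    (1 <= N)%N ->
    C1 / (CR0 - Cy) ^+ 2 / delta <= (N%:R) `^ (2 * beta - 1) ->
    Cgamma * (N%:R) `^ (- (1 - beta)) <= gamma ->
    forall (dO : measure_display) (Omega : measurableType dO)
           (P : probability Omega R) (th0 : 'I_N -> Omega -> param R d),
    iid_law P mu0 th0 ->
    let gN := gamma / (N%:R) `^ (2 * beta - 1) in
    let L := loss beta sigma x y in
    let theta k w := iter k (lmstep alpha gN L) (init_param (th0^~ w)) in
    let event := [set w : Omega |
      (forall k, (k < K)%N -> sysmat gN L (theta k w) \in unitmx) /\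
      norm2f (fun m => fnet beta sigma (theta K w) (x m) - y m) <=
        C * Num.sqrt (M%:R) / delta *
          ((N%:R) `^ (- (beta - 1 / 2)) + (N%:R) `^ (- (1 - beta))
           + ln (M%:R) / (N%:R) `^ (1 / 2))
        + (1 - alpha * lmin) ^+ K * norm2f y] in
    exists A : set Omega, measurable A /\ A `<=` event /\
      ((1 - 2 * delta)%:E <= P A)%E.
Proof.
move=> d1 good; have [A A1 cA] := good_init_bound good.
have A0 : 0 < A by exact: lt_le_trans A1.
pose Gs := 1 + `|Cs|; have Gs1 : 1 <= Gs by rewrite lerDl.
have AGs1 : 1 <= A * Gs by rewrite mulr_ege1.
have AGs0 : 0 < A * Gs by exact: lt_le_trans AGs1.
(* The squared bound on a single term [c * sigma (...)]. [Gs] is separate from [G] below because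
   this constant is chosen before [Cx]. *)
exists ((A * Gs) ^+ 2); split; first by rewrite exprn_gt0.
move=> K CR0 alpha gamma M Cx Cy gamma0 M0 CyC alpha0.
pose G := 1 + `|Cs| + `|Cs'| + `|Cs''| + `|Ls| + `|Ls'| + `|Cx|.
have [G1 gCs gCs' gCs''] : [/\ 1 <= G, Cs <= G, Cs' <= G & Cs'' <= G].
  have := normr_ge0 Cs; have := normr_ge0 Cs'; have := normr_ge0 Cs''.
  have := normr_ge0 Ls; have := normr_ge0 Ls'; have := normr_ge0 Cx.
  have := ler_norm Cs; have := ler_norm Cs'; have := ler_norm Cs''.
  by rewrite /G => *; split; lra.
have [gLs gLs' gCx] : [/\ Ls <= G, Ls' <= G & Cx <= G].
  have := normr_ge0 Cs; have := normr_ge0 Cs'; have := normr_ge0 Cs''.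
  have := normr_ge0 Ls; have := normr_ge0 Ls'; have := normr_ge0 Cx.
  have := ler_norm Ls; have := ler_norm Ls'; have := ler_norm Cx.
  by rewrite /G => *; split; lra.
pose Gk := kernel_bound d A G.
have Gk0 : 0 <= Gk.
  have G0 : 0 <= G by exact: le_trans G1.
  by rewrite /Gk /kernel_bound !(addr_ge0, mulr_ge0)// ltW.
have M0R : 0 < M%:R :> R by rewrite ltr0n.
have M1R : 1 <= M%:R :> R by rewrite ler1n.
(* Dominates the initial data of [lm_iterates]: outer weights, residuals (output plus label), and
   the kernel error relative to [e]. *)
pose Q := 1 + A + (M%:R * (CR0 - Cy) + `|Cy|) + 2 * Gk.
have MC0 : 0 <= M%:R * (CR0 - Cy) by rewrite mulr_ge0// subr_ge0 ltW.
have [Q1 QA Qr QG] : [/\ 1 <= Q, A <= Q, M%:R * (CR0 - Cy) + `|Cy| <= Q & 2 * Gk <= Q].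
  by have := normr_ge0 Cy; rewrite /Q => *; split; lra.
have [C C1 iterC] := @lm_iterates R d M G gamma alpha Q K M0 G1 Q1 gamma0 alpha0.
(* Accounts for the initial network outputs, of size [M (A Gs) u / delta], carried through [K]
   applications of the limiting map. *)
pose F := (1 + alpha * (1 + M%:R)) ^+ K * (M%:R * (A * Gs)).
have F0 : 0 <= F.
  by rewrite mulr_ge0 ?mulr_ge0 ?exprn_ge0 ?addr_ge0 ?mulr_ge0 ?addr_ge0// ltW.
have C0 : 0 < C by exact: lt_le_trans C1.
exists C, (C + F); split=> //; split; first by rewrite ltr_wpDr.
move=> delta beta sigma x y lmin lmax N hdelta hbeta act data lminP lmaxP alphaP N0 HC1 HCg.
move=> dO Omega P th0 iid gN L theta event.
have [delta0 delta1] := andP hdelta.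
have bact : bounded_activation sigma G by exact: good_activation_bounded act _.
have sGs t : `|sigma t| <= Gs.
  have [_ [_ [_ [sCs _]]]] := act.
  by rewrite (le_trans (sCs t))// (le_trans (ler_norm Cs))// lerDr.
have [xC [yC _]] := data.
have xG m j : `|x m 0 j| <= G.
  by rewrite (le_trans (norm2_coord _ _))// (le_trans (xC m)).
pose Bs := Bstar0 mu0 sigma x.
have psd := Bstar0_psd A1 cA M0 bact xG.
have Bsym := Bstar0_sym cA x bact.
have [E [mE PE HE]] := init_event A1 good cA M0 G1 Gs1 bact sGs xG N0 delta0 iid.
exists E; split=> //; split=> // w Ew.
have [cofA outA kerA] := HE w Ew.
set th := init_param _ in cofA outA kerA.
have [u0 /andP[h0 h1] NE sN Nu] := rates N0 hbeta hdelta.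
set u := N%:R `^ (- (beta - 1 / 2)) in u0 NE sN Nu *.
set h := N%:R `^ (- (1 - beta)) in h0 h1 *.
set s := N%:R `^ (- beta) in sN.
have NR : 0 < N%:R :> R by rewrite ltr0n.
pose f0 m := fnet beta sigma th (x m).
have f0sq m : f0 m ^+ 2 <= M%:R * ((A * Gs) ^+ 2 * u ^+ 2 / delta).
  rewrite (_ : f0 m ^+ 2 = s ^+ 2 * (\sum_(i < N) cof th i * sigma (preact (x m) th i)) ^+ 2).
    apply: (@le_trans _ _ (s ^+ 2 * (M%:R * (N%:R * (A * Gs) ^+ 2) / delta))).
      rewrite ler_wpM2l ?sqr_ge0//; apply: le_trans outA.
      exact: (sqr_le_sum (fun m => \sum_(i < N) cof th i * sigma (preact (x m) th i))).
    by rewrite -sN le_eqVlt; apply/orP; left; apply/eqP; ring.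
  by rewrite -exprMn.
have MAG0 : 0 <= M%:R * (A * Gs) by rewrite mulr_ge0// ltW.
have f0u m : `|f0 m| <= M%:R * (A * Gs) * (u / delta).
  apply: sqr_le_quot => //; first exact: ltW.
  apply: (le_trans (f0sq m)).
  rewrite [X in _ <= X](_ : _ = M%:R ^+ 2 * ((A * Gs) ^+ 2 * u ^+ 2 / delta)); last by ring.
  apply: ler_wpM2r; last by rewrite expr2 ler_peMl.
  by apply: divr_ge0; [rewrite mulr_ge0 ?sqr_ge0|exact: ltW].
(* The lower bound on the width says exactly that [(A * Gs) ^ 2 * u ^ 2 / delta <= (CR0 - Cy) ^ 2];
   this makes the initial residual bounded independently of [delta] and [N]. *)
have f0R m : `|f0 m| <= M%:R * (CR0 - Cy).
  apply: le_sqr_norm => //; apply: (le_trans (f0sq m)).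
  apply: (@le_trans _ _ (M%:R * (CR0 - Cy) ^+ 2)).
    rewrite ler_pM2l//; move: HC1; rewrite NE.
    have cc : 0 < (CR0 - Cy) ^+ 2 by rewrite exprn_gt0// subr_gt0.
    rewrite ler_pdivrMr// ler_pdivrMr// => HC1.
    rewrite ler_pdivrMr// -ler_pdivlMr ?exprn_gt0//.
    by apply: (le_trans HC1); rewrite le_eqVlt; apply/orP; left; apply/eqP; ring.
  by rewrite exprMn; apply: ler_wpM2r; rewrite ?sqr_ge0// expr2 ler_peMl.
pose e := h + u / delta.
have ud0 : 0 < u / delta by rewrite divr_gt0.
have he : h <= e by rewrite lerDl ltW.
have Bdiff m n : `|empirical_kernel sigma x th m n - Bs m n| <= Q * e.
  apply: (@le_trans _ _ (2 * Gk * (u / delta))); last first.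
    by apply: ler_pM => //; [rewrite mulr_ge0|exact: ltW|rewrite lerDr ltW].
  apply: sqr_le_quot => //; [by rewrite mulr_ge0|exact: ltW|].
  have NM0 : 0 < (N%:R * M%:R) ^+ 2 :> R by rewrite exprn_gt0// mulr_gt0.
  rewrite -(ler_pM2l NM0).
  apply: (@le_trans _ _ ((M * M)%:R * (N%:R * (2 * Gk) ^+ 2) / delta)).
    apply: le_trans (kerA m n); rewrite le_eqVlt; apply/orP; left; apply/eqP.
    by rewrite /Bs; ring.
  rewrite natrM (_ : M%:R * M%:R * (N%:R * (2 * Gk) ^+ 2) / delta =
    (N%:R * M%:R) ^+ 2 * (N%:R^-1 * ((2 * Gk) ^+ 2 / delta))).
    rewrite ler_pM2l// [X in _ <= X](_ : _ = u ^+ 2 * ((2 * Gk) ^+ 2 / delta)).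
      by rewrite ler_wpM2r// divr_ge0 ?sqr_ge0// ltW.
    by ring.
  by field; rewrite !gt_eqF.
have cofQ i : `|cof th i| <= Q by exact: le_trans QA.
have rQ m : `|(\col_m (fnet beta sigma th (x m) - y m)) m 0| <= Q.
  rewrite mxE; apply: le_trans Qr; apply: normD_le; first exact: f0R.
  by rewrite normrN (le_trans (yC m))// ler_norm.
have [unitS [_ _ _ errK]] := iterC N beta sigma x y th Bs e N0 h1 he bact xG psd rQ cofQ Bdiff HCg.
split; first exact: unitS.
have CF0 : 0 <= C + F by rewrite addr_ge0// ltW.
have uh0 : 0 <= u + h by rewrite addr_ge0 ?(ltW u0)// ltW.
pose T := contraction Bs gamma alpha.
pose F0c : 'cV[R]_M := \col_m f0 m; pose Y : 'cV[R]_M := \col_m y m.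
have r0E : \col_m (fnet beta sigma th (x m) - y m) = F0c - Y.
  by apply/colP => m; rewrite !mxE.
(* The initial residual is outputs minus labels, so by linearity the limiting residual is
   [T^K F0c - T^K Y]. Adding [T^K Y] leaves only the small terms; the removed part is contracted at
   the sharp rate. *)
pose b m := fnet beta sigma (theta K w) (x m) - y m + iter K T Y m 0.
have bE m : `|b m| <= (C + F) * ((u + h) / delta).
  have -> : b m = (\col_m (fnet beta sigma (theta K w) (x m) - y m) -
      iter K T (\col_m (fnet beta sigma th (x m) - y m))) m 0 + iter K T F0c m 0.
    rewrite r0E /T iter_contractionB -/T /b !mxE.
    by ring.
  apply: (@le_trans _ _ (C * e + F * (u / delta))).
    apply: normD_le; first exact: errK.
    rewrite /F -mulrA; apply: iter_contraction_le => //.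
      by rewrite mulr_ge0 ?ltW// mulr_gt0.
    by move=> k; rewrite mxE.
  rewrite mulrDl lerD//.
    rewrite ler_pM2l// /e mulrDl addrC lerD2l ler_peMr ?(ltW h0)//.
    by rewrite invf_ge1//; lra.
  by rewrite ler_wpM2l// ler_pM2r ?invr_gt0// lerDl ltW.
have -> : norm2f (fun m => fnet beta sigma (theta K w) (x m) - y m) =
    norm2f (fun m => b m + - iter K T Y m 0).
  by congr norm2f; apply/funext => m; rewrite /b addrK.
apply: (le_trans (norm2fD _ _)); apply: lerD.
  apply: (le_trans (norm2f_le _ bE)).
    by rewrite mulr_ge0// divr_ge0// ltW.
  rewrite [X in X <= _](_ : _ = (C + F) * Num.sqrt M%:R / delta * (u + h)); last by ring.
  rewrite ler_wpM2l//.
    by apply: divr_ge0; [rewrite mulr_ge0// sqrtr_ge0|exact: ltW].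
  (* For [M >= 1] the logarithm is nonnegative, so [u + h] is at most the stated rate. *)
  by rewrite lerDl divr_ge0 ?powR_ge0// ln_ge0.
have -> : norm2f (fun m => - iter K T Y m 0) = norm2f (fun m => iter K T Y m 0).
  by rewrite /norm2f; congr Num.sqrt; apply: eq_bigr => m _; rewrite sqrrN.
have -> : norm2f y = norm2f (fun m => Y m 0).
  by congr norm2f; apply/funext => m; rewrite mxE.
exact: (iter_contraction_norm gamma0 alpha0 psd Bsym lminP lmaxP alphaP).
Qed.
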